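(* Let $\mathfrak{g} = \mathbb{C} \oplus \mathfrak{spin}(10,\mathbb{C})$ and let $V$ be one of its two standard $16$-dimensional spin representations, realised through the grading $\mathfrak{e}_6 = V \oplus \mathfrak{g} \oplus V^*$. Then the component $H^2(V,\mathfrak{g}) \cap (\wedge^2 V^* \otimes \mathfrak{g})$ of the second Lie algebra cohomology is zero, that is, $$\{\psi \in \wedge^2 V^* \otimes \mathfrak{g} : \partial_{Lie}\psi = 0\} = \partial_{Lie}(V^* \otimes V^* ),$$ and consequently the formal curvature module $K(\mathbb{C} \oplus \mathfrak{spin}(10,\mathbb{C}))$ is of Ricci-type: every element of $K(\mathfrak{g})$ is determined by its Ricci trace.
   Context: All vector spaces are over $\mathbb{C}$. The complex exceptional Lie algebra $\mathfrak{e}_6$ has a one-grading $\mathfrak{e}_6 = V \oplus \mathfrak{g} \oplus V^*$ with $V \cong \mathbb{C}^{16}$ in degree $-1$, $\mathfrak{g} = \mathbb{C} \oplus \mathfrak{spin}(10,\mathbb{C})$ in degree $0$ and $V^* \cong \mathbb{C}^{16*}$ in degree $1$; here $V$ is a standard $16$-dimensional spin representation of $\mathfrak{spin}(10,\mathbb{C})$, with the centre $\mathbb{C}$ acting by scalars. Both $V$ and $V^*$ are abelian subalgebras. The inclusion $\mathfrak{g} \subset V^* \otimes V$ is given by $A \cdot v = [v,A] = -[A,v]$ (brackets in $\mathfrak{e}_6$), i.e. the bracket of $\mathfrak{g}$ with $V$ is minus the action. Formal curvature module: $K(\mathfrak{g})$ is the space of all $R \in \wedge^2 V^* \otimes \mathfrak{g}$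 satisfying the algebraic Bianchi identity $R(u,v)\cdot w + R(v,w)\cdot u + R(w,u)\cdot v = 0$ for all $u,v,w \in V$. Ricci-type: the Ricci trace of $R \in \wedge^2 V^* \otimes \mathfrak{g}$ is the element of $V^* \otimes V^*$ given by $(v,w) \mapsto \mathrm{tr}\big(u \mapsto R(u,v)\cdot w\big)$. $K(\mathfrak{g})$ is of Ricci-type if every element of $K(\mathfrak{g})$ is determined by its Ricci trace, i.e. the Ricci trace is injective on $K(\mathfrak{g})$. Lie algebra cohomology: $\partial_{Lie} : \wedge^k V^* \otimes \mathfrak{e}_6 \to \wedge^{k+1} V^* \otimes \mathfrak{e}_6$ is $$(\partial_{Lie}\psi)(v_0,\ldots,v_k) = \sum_{i=0}^k (-1)^i [v_i, \psi(v_0,\ldots,\hat{v_i},\ldots,v_k)],$$ with hats denoting omission. It satisfies $\partial_{Lie}^2 = 0$, and $H^k(V,\mathfrak{g})$ denotes (in this notation) the $k$-th cohomology of this complex. Since $\partial_{Lie}$ respects the grading, it maps $V^*\otimes V^*$ to $\wedge^2 V^* \otimes \mathfrak{g}$ and $\wedge^2 V^* \otimes \mathfrak{g}$ to $\wedge^3 V^* \otimes V$; the component $H^2(V,\mathfrak{g}) \cap (\wedge^2 V^* \otimes \mathfrak{g})$ is the cohomology at $\wedge^2 V^* \otimes \mathfrak{g}$, namely $\ker(\partial_{Lie}|_{\wedge^2 V^* \otimes \mathfrak{g}})/\partial_{Lie}(V^* \otimes V^* )$. *)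

(* Defs.v *)
From HB Require Import structures.
From mathcomp Require Import all_boot all_order all_algebra ring.
From mathcomp Require Export reals complex.

Set Implicit Arguments.
Unset Strict Implicit.
Unset Printing Implicit Defensive.

Import GRing.Theory.
Local Open Scope ring_scope.

Section Forms.
Variables (F : fieldType) (V E : vectType F).
Implicit Types (k : nat) (U : {vspace E}).

Definition set_arg k (v : k.-tuple V) (i : 'I_k) (x : V) : k.-tuple V :=
  [tuple if j == i then x else tnth v j | j < k].

Definition omit_arg k (v : k.+1.-tuple V) (i : 'I_k.+1) : k.-tuple V :=
  [tuple tnth v (lift i j) | j < k].

Definition multilinear k (psi : k.-tuple V -> E) : Prop :=
  forall (v : k.-tuple V) (i : 'I_k) (a : F) (x y : V),
    psi (set_arg v i (a *: x + y)) =
      a *: psi (set_arg v i x) + psi (set_arg v i y).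

Definition alternating k (psi : k.-tuple V -> E) : Prop :=
  forall (v : k.-tuple V) (i j : 'I_k),
    i != j -> tnth v i = tnth v j -> psi v = 0.

(* The space Lambda^k V^* (x) U, for a subspace U of E. *)
Definition wedge k U (psi : k.-tuple V -> E) : Prop :=
  [/\ multilinear psi, alternating psi & forall v, psi v \in U].

End Forms.

Section Curvature.
Variables (F : fieldType) (I : finType).
Local Notation V := {ffun I -> F^o}.
Variable g : {vspace 'End(V)}.

Definition curvature (R : 2.-tuple V -> 'End(V)) : Prop :=
  wedge g R /\
  forall u v w : V,
    R [tuple u; v] w + R [tuple v; w] u + R [tuple w; u] v = 0.

Definition std_basis (i : I) : V := [ffun j => (j == i)%:R].

Definition trace (f : V -> V) : F := \sum_(i : I) f (std_basis i) i.

Definition ricci (R : 2.-tuple V -> 'End(V)) (v w : V) : F :=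
  trace (fun u => R [tuple u; v] w).

Definition ricci_type : Prop :=
  forall R1 R2, curvature R1 -> curvature R2 ->
    (forall v w, ricci R1 v w = ricci R2 v w) -> R1 =1 R2.

End Curvature.

Section Lie.
Variables (F : fieldType) (L : vectType F) (br : L -> L -> L).

Record is_lie_bracket : Prop := IsLieBracket {
  lie_linearl : forall a x y z, br (a *: x + y) z = a *: br x z + br y z;
  lie_linearr : forall a x y z, br z (a *: x + y) = a *: br z x + br z y;
  lie_alt : forall x, br x x = 0;
  lie_jacobi : forall x y z,
    br x (br y z) + br y (br z x) + br z (br x y) = 0 }.

(* The differential on forms on V with values in L, for a map iota of V onto
   an abelian subalgebra of L. *)
Definition d_Lie (V : vectType F) (iota : V -> L) k (psi : k.-tuple V -> L)
    (v : k.+1.-tuple V) : L :=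
  \sum_(i < k.+1) (-1) ^+ i *: br (iota (tnth v i)) (psi (omit_arg v i)).

(* Nodes 0, ..., 5 are the nodes 1, ..., 6 of Bourbaki's labelling:
     0 - 2 - 3 - 4 - 5   with node 1 attached to node 3. *)
Definition e6_edge (i j : 'I_6) : bool :=
  (nat_of_ord i, nat_of_ord j)
    \in [:: (0, 2); (2, 3); (3, 4); (4, 5); (1, 3)]%N.

Definition e6_linked (i j : 'I_6) : bool := e6_edge i j || e6_edge j i.

Definition e6_cartan (i j : 'I_6) : F :=
  if i == j then 2%:R else if e6_linked i j then -1 else 0.

(* L is the exceptional Lie algebra e6, through its Serre presentation: the
   algebra so presented is simple, hence L, a nonzero quotient of it, is e6.
   The Serre relations ad(e_i)^(1 - a_ij) e_j = 0 are written out for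
   a_ij = -1 and a_ij = 0. *)
Definition is_e6 : Prop :=
  [/\ is_lie_bracket, (fullv : {vspace L}) <> 0%VS &
   exists e f h : 'I_6 -> L,
    [/\ forall i j, br (h i) (h j) = 0,
        forall i j, br (e i) (f j) = if i == j then h i else 0,
        forall i j, br (h i) (e j) = e6_cartan i j *: e j /\
                    br (h i) (f j) = - e6_cartan i j *: f j,
        forall i j, i != j ->
          if e6_linked i j then br (e i) (br (e i) (e j)) = 0 /\
                                br (f i) (br (f i) (f j)) = 0
          else br (e i) (e j) = 0 /\ br (f i) (f j) = 0 &
        forall U : {vspace L},
          (forall x y, x \in U -> y \in U -> br x y \in U) ->
          (forall i, [/\ e i \in U, f i \in U & h i \in U]) ->
          U = fullv]].

End Lie.

Section Spin.
Variable F : fieldType.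

(* Lambda W for W = F^5 with basis e_0, ..., e_4: the value of a spinor at A
   is its coefficient on e_A, the product of the e_i, i in A, in increasing
   order. *)
Definition spinor := {ffun {set 'I_5} -> F^o}.

Definition spin_sign (i : 'I_5) (A : {set 'I_5}) : F :=
  (-1) ^+ #|[set j in A | (j < i)%N]|.

(* Exterior multiplication by e_i, and contraction with the dual vector of
   e_i, on coefficients. *)
Definition ext_mul (i : 'I_5) (s : spinor) : spinor :=
  [ffun A : {set 'I_5} => if i \in A then spin_sign i A *: s (A :\ i) else 0].

Definition contract (i : 'I_5) (s : spinor) : spinor :=
  [ffun A : {set 'I_5} => if i \in A then 0 else spin_sign i A *: s (i |: A)].

Lemma ext_mul_linear i : linear (ext_mul i).
Proof.
move=> a s t; apply/ffunP=> A; rewrite !ffunE.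
by case: ifP => _; rewrite ?scaler0 ?addr0 // scalerDr !scalerA mulrC.
Qed.

Lemma contract_linear i : linear (contract i).
Proof.
move=> a s t; apply/ffunP=> A; rewrite !ffunE.
by case: ifP => _; rewrite ?scaler0 ?addr0 // scalerDr !scalerA mulrC.
Qed.

HB.instance Definition _ i := GRing.isLinear.Build F spinor spinor *:%R
  (ext_mul i) (ext_mul_linear i).
HB.instance Definition _ i := GRing.isLinear.Build F spinor spinor *:%R
  (contract i) (contract_linear i).

(* Clifford action of the basis (true, i) of W and (false, i) of W^* of the
   quadratic space W + W^* = F^10, with its hyperbolic form. *)
Definition gamma (x : bool * 'I_5) : 'End(spinor) :=
  if x.1 then linfun (ext_mul x.2) else linfun (contract x.2).

Let flip (i : 'I_5) (A : {set 'I_5}) := if i \in A then A :\ i else i |: A.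

Let in_flip i j A : (i \in flip j A) = (i == j) (+) (i \in A).
Proof.
by rewrite /flip; case: ifP => jA; rewrite !inE; case: eqVneq => // ->;
   rewrite jA.
Qed.

Let flipC i j A : flip i (flip j A) = flip j (flip i A).
Proof. by apply/setP=> k; rewrite !in_flip addbCA. Qed.

Let flipK i A : flip i (flip i A) = A.
Proof. by apply/setP=> k; rewrite !in_flip addKb. Qed.

Let sign_flip i j A : spin_sign i (flip j A) = (-1) ^+ (j < i)%N * spin_sign i A.
Proof.
rewrite /spin_sign; set B := [set k in flip j A | _]; set D := [set k in A | _].
have inB k : k != j -> (k \in B) = (k \in D).
  by rewrite !inE in_flip => /negPf ->.
have jB : (j \in B) = (j \notin A) && (j < i)%N by rewrite !inE in_flip eqxx.
have jD : (j \in D) = (j \in A) && (j < i)%N by rewrite !inE.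
have eBD : B :\ j = D :\ j.
  by apply/setP=> k; rewrite [LHS]in_setD1 [RHS]in_setD1;
     case: (eqVneq k j) => //= /inB.
rewrite (cardsD1 j B) (cardsD1 j D) eBD jB jD !exprD mulrA.
congr (_ * _); case: (j \in A); case: (j < i)%N;
  by rewrite /= ?expr1 ?expr0 ?mulrNN ?mulr1.
Qed.

Let gammaE x (s : spinor) A :
  gamma x s A = if (x.2 \in A) == x.1 then spin_sign x.2 A * s (flip x.2 A)
                else 0.
Proof.
by case: x => [[] i]; rewrite /gamma /= lfunE ffunE /flip; case: (i \in A).
Qed.

Lemma gamma_clifford (x y : bool * 'I_5) :
  ((gamma x \o gamma y) + (gamma y \o gamma x) =
    ((x.1 != y.1) && (x.2 == y.2))%:R *: \1)%VF.
Proof.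
apply/lfunP=> s; rewrite add_lfunE !comp_lfunE scale_lfunE id_lfunE.
apply/ffunP=> A; rewrite !ffunE !gammaE !in_flip !sign_flip.
case: x y => [p i] [q j] /=; rewrite scaler_nat.
case: (eqVneq i j) => [<-|neq_ij].
  rewrite ltnn expr0 mul1r flipK.
  have sK c : spin_sign i A * (spin_sign i A * c) = c.
    by rewrite mulrA -expr2 sqrr_sign mul1r.
  by case: (i \in A); case: p; case: q;
     rewrite /= ?sK ?mulr0 ?addr0 ?add0r.
rewrite (flipC j i) !addFb andbF mulr0n.
case: ((i \in A) == p); case: ((j \in A) == q);
  rewrite ?mulr0 ?addr0 // !mulrA.
by case: (ltngtP i j) neq_ij => [|| /val_inj ->]; rewrite ?eqxx //= => *; ring.
Qed.

(* Basis of Lambda^even W (b = false) or Lambda^odd W (b = true). *)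
Definition half_index (b : bool) : finType :=
  {A : {set 'I_5} | odd #|A| == b}.

Definition half_spinor (b : bool) := {ffun half_index b -> F^o}.

Definition half_in b (s : half_spinor b) : spinor :=
  [ffun A : {set 'I_5} => oapp s 0 (insub A)].

Definition half_out b (s : spinor) : half_spinor b := [ffun u => s (val u)].

Lemma half_in_linear b : linear (@half_in b).
Proof.
move=> a s t; apply/ffunP=> A; rewrite !ffunE.
by case: insub => [u|] /=; rewrite ?ffunE ?scaler0 ?addr0.
Qed.

Lemma half_out_linear b : linear (@half_out b).
Proof. by move=> a s t; apply/ffunP=> A; rewrite !ffunE. Qed.

HB.instance Definition _ b := GRing.isLinear.Build F (half_spinor b) spinor
  *:%R (@half_in b) (@half_in_linear b).
HB.instance Definition _ b := GRing.isLinear.Build F spinor (half_spinor b)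
  *:%R (@half_out b) (@half_out_linear b).

Definition half_end b (x : 'End(spinor)) : 'End(half_spinor b) :=
  (linfun (@half_out b) \o x \o linfun (@half_in b))%VF.

(* spin(10) is the span of the commutators [u, v], for u, v in F^10, in the
   Clifford algebra; these preserve both half-spin spaces, on which spin(10)
   acts faithfully. *)
Definition spin10 b : {vspace 'End(half_spinor b)} :=
  (\sum_(x : bool * 'I_5) \sum_(y : bool * 'I_5)
     <[half_end b ((gamma x \o gamma y) - (gamma y \o gamma x))%VF]>)%VS.

Definition cspin10 b : {vspace 'End(half_spinor b)} :=
  (<[\1%VF]> + spin10 b)%VS.

End Spin.

Section OneGrading.
Variables (F : fieldType) (V : vectType F) (g : {vspace 'End(V)}).

Definition graded : vectType F := (V * subvs_of g * 'Hom(V, F^o))%type.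

Definition in_deg_m1 (v : V) : graded := (v, 0, 0).
Definition in_deg0 (A : subvs_of g) : graded := (0, A, 0).
Definition in_deg1 (p : 'Hom(V, F^o)) : graded := (0, 0, p).

Lemma in_deg_m1_linear : linear in_deg_m1.
Proof.
move=> a v w; rewrite /in_deg_m1; by congr (_, _, _); rewrite /= scaler0 addr0.
Qed.

Lemma in_deg0_linear : linear in_deg0.
Proof.
move=> a A B; rewrite /in_deg0; by congr (_, _, _); rewrite /= scaler0 addr0.
Qed.

Lemma in_deg1_linear : linear in_deg1.
Proof.
move=> a p q; rewrite /in_deg1; by congr (_, _, _); rewrite /= scaler0 addr0.
Qed.

HB.instance Definition _ := GRing.isLinear.Build F V graded *:%R
  in_deg_m1 in_deg_m1_linear.
HB.instance Definition _ := GRing.isLinear.Build F (subvs_of g) graded *:%R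
  in_deg0 in_deg0_linear.
HB.instance Definition _ := GRing.isLinear.Build F 'Hom(V, F^o) graded *:%R
  in_deg1 in_deg1_linear.

Definition deg0 : {vspace graded} := limg (linfun in_deg0).
Definition deg1 : {vspace graded} := limg (linfun in_deg1).

(* The bracket respects the degrees -1, 0, 1, with g acting on V by
   A v = [v, A] = - [A, v] and on V^* by the dual of v |-> [A, v].
   The bracket of g with itself is determined by the Jacobi identity on
   V x g x g: [A, B] = - (A \o B - B \o A). *)
Record one_grading (br : graded -> graded -> graded) : Prop := OneGrading {
  grading_m1_m1 : forall v w, br (in_deg_m1 v) (in_deg_m1 w) = 0;
  grading_m1_0 : forall v A,
    br (in_deg_m1 v) (in_deg0 A) = in_deg_m1 (vsval A v);
  grading_m1_1 : forall v p, br (in_deg_m1 v) (in_deg1 p) \in deg0;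
  grading_0_0 : forall A B, br (in_deg0 A) (in_deg0 B) \in deg0;
  grading_0_1 : forall A p,
    br (in_deg0 A) (in_deg1 p) = in_deg1 (p \o vsval A)%VF;
  grading_1_1 : forall p q, br (in_deg1 p) (in_deg1 q) = 0 }.

End OneGrading.

Arguments in_deg_m1 {F V} g v.

(* Main.v *)
Require Import Defs.
From Stdlib Require Import ZArith FMapPositive.
From HB Require Import structures.
From mathcomp Require Import all_boot all_order all_algebra.
From mathcomp Require Import zify ssrZ ring boolp.

Set Implicit Arguments.
Unset Strict Implicit.
Unset Printing Implicit Defensive.

Import GRing.Theory Num.Theory.

(** Write T(v, p) in g for the bracket [v, p] of v in V and p in V^*. The Jacobi
identity gives T(v, p) w = T(w, p) v. A map phi : V -> V^* therefore yields a
formal curvature (u, v) |-> T(u, phi v) - T(v, phi u), which is the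
differential of phi, and a form with values in degree 0 is closed exactly when
it satisfies the algebraic Bianchi identity. So the claim is that every formal
curvature R comes from some phi, and that R is determined by its Ricci trace.
Three facts carry this:

- a formal curvature with zero Ricci trace vanishes ([ricci_flat_zero]), which
  is the statement on the Ricci type;
- the second prolongation of g vanishes: a symmetric bilinear map Q from V to
  g such that Q(u, v) w is symmetric in u, v, w is zero
  ([second_prolongation_zero]);
- T(., p) = 0 only for p = 0 ([cspin_pairing_inj]).

If phi has differential zero, then T(u, phi v) w is symmetric in u, v, w, hence
zero by the second fact, and phi = 0 by the third. With the first fact, sending
phi to the Ricci trace of its differential is an injective, hence bijective,
endomorphism of the 256-dimensional space of bilinear forms on V. Given a
formal curvature R, choose phi whose differential has the Ricci trace of R; by
the first fact the two curvatures agree ([curvature_coboundary]).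

For the third fact, the p with T(., p) = 0 form a g-submodule of the
irreducible module V^*. If it were everything, the degree 0 part of any bracket
would be a commutator in g, of trace 0 on V. But e6 is perfect and its degree 0
part contains the identity of V, of trace 16.

The first two facts are homogeneous linear systems with small integer
coefficients. In the basis of V indexed by the subsets of {0, ..., 4} of the
given parity, written as words of five bits, an element x of g is given by 46
coordinates: one for the centre, five for the Cartan subalgebra of spin(10),
and one for each of the 40 roots. The entry of x from e_c to e_d with c <> d is
nonzero only if c and d differ in exactly two places, and it is then, up to
sign, the coordinate of x at the root that is the difference of the weights of
d and c. This gives 120 * 46 = 5520 unknowns for the curvature and
136 * 46 = 6256 for the second prolongation, and equations with so few terms
that Gaussian elimination, proved correct below, shows by computation that both
systems have only the zero solution in characteristic 0. *)

Local Open Scope ring_scope.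

(** * Homogeneous linear systems with integer coefficients *)

(** A linear form as the list of its terms, by increasing unknown. The
lemmas on [eval] hold for lists in any order; the order only makes the
elimination effective. *)
Definition lincomb := seq (positive * Z).

Definition scale_form (z : Z) (f : lincomb) : lincomb :=
  [seq (t.1, Z.mul z t.2) | t <- f].

Fixpoint add_form (f : lincomb) : lincomb -> lincomb :=
  if f is (k, a) :: f' then
    fix add_f (g : lincomb) : lincomb :=
      if g is (l, c) :: g' then
        match Pos.compare k l with
        | Lt => (k, a) :: add_form f' g
        | Gt => (l, c) :: add_f g'
        | Eq => let s := Z.add a c in
                if Z.eqb s Z0 then add_form f' g' else (k, s) :: add_form f' g'
        end
      else f
  else id.

Arguments add_form : simpl never.
Arguments scale_form : simpl never.

(** The rows found so far, each stored at its leading unknown. *)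
Definition rows := PositiveMap.t lincomb.

(** Cancels the leading unknown of [f] as long as some row leads with it. The
multipliers are divided by the gcd of the two leading coefficients to keep the
integers small; [n] bounds the number of steps. *)
Fixpoint reduce (n : nat) (T : rows) (f : lincomb) : lincomb :=
  if n is n'.+1 then
    if f is (k, c) :: _ then
      if PositiveMap.find k T is Some (((_, a) :: _) as r) then
        let d := Z.gcd a c in
        reduce n' T (add_form (scale_form (Z.div a d) f)
                              (scale_form (Z.opp (Z.div c d)) r))
      else f
    else f
  else f.

Definition insert_row (T : rows) (f : lincomb) : rows :=
  if reduce 1000 T f is (k, c) :: f' then
    PositiveMap.add k ((k, c) :: f') T
  else T.

Definition echelon (fs : seq lincomb) : rows :=
  foldl insert_row (PositiveMap.empty _) fs.

(** Every row leads with the unknown under which it is stored, and its other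
unknowns are larger and lead rows themselves. The bound [M] on the leading
unknowns makes downward induction possible. *)
Definition triangular (M : positive) (T : rows) : bool :=
  all (fun kr : positive * lincomb =>
    if kr.2 is (l, a) :: r then
      [&& Pos.eqb l kr.1, ~~ Z.eqb a Z0, Pos.ltb l M &
         all (fun t => Pos.ltb l t.1 && PositiveMap.mem t.1 T) r]
    else false) (PositiveMap.elements T).

Section Solve.
Variable F : numFieldType.

Definition of_Z (z : Z) : F := (int_of_Z z)%:~R.

Lemma of_ZD y z : of_Z (Z.add y z) = of_Z y + of_Z z.
Proof. by rewrite /of_Z -[Z.add y z]/(y + z) !rmorphD. Qed.

Lemma of_ZM y z : of_Z (Z.mul y z) = of_Z y * of_Z z.
Proof. by rewrite /of_Z -[Z.mul y z]/(y * z) !rmorphM. Qed.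

Lemma of_Z_eq0 z : (of_Z z == 0) = Z.eqb z Z0.
Proof.
rewrite /of_Z intr_eq0; apply/eqP/Z.eqb_spec; last by move=> ->.
by move=> z0; rewrite -[z]int_of_ZK z0.
Qed.

Variable x : positive -> F.

Definition eval (f : lincomb) : F := \sum_(t <- f) of_Z t.2 * x t.1.

Lemma eval_cons k z f : eval ((k, z) :: f) = of_Z z * x k + eval f.
Proof. by rewrite /eval big_cons. Qed.

Lemma eval_zero f : (forall t, List.In t f -> x t.1 = 0) -> eval f = 0.
Proof.
elim: f => [|[k z] f IHf] f0; first by rewrite /eval big_nil.
rewrite eval_cons (f0 (k, z)) ?mulr0 ?add0r; last by left.
by apply: IHf => t ft; apply: f0; right.
Qed.

Lemma eval_scale z f : eval (scale_form z f) = of_Z z * eval f.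
Proof.
rewrite /eval big_map mulr_sumr; apply: eq_bigr => t _.
by rewrite of_ZM mulrA.
Qed.

Lemma eval_add f g : eval (add_form f g) = eval f + eval g.
Proof.
elim: f g => [|[k a] f IHf] g; first by rewrite /eval big_nil add0r.
elim: g => [|[l c] g IHg]; first by rewrite /eval big_nil addr0.
have e : add_form ((k, a) :: f) ((l, c) :: g) =
  match Pos.compare k l with
  | Lt => (k, a) :: add_form f ((l, c) :: g)
  | Gt => (l, c) :: add_form ((k, a) :: f) g
  | Eq => let s := Z.add a c in
          if Z.eqb s Z0 then add_form f g else (k, s) :: add_form f g
  end by [].
rewrite {}e; case: (Pos.compare_spec k l) => [<-|_|_].
- have -> h : eval (let s := (a + c)%Z in
      if Z.eqb s Z0 then h else (k, s) :: h) = (of_Z a + of_Z c) * x k + eval h.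
    rewrite /= -of_ZD -of_Z_eq0; case: eqP => [->|_]; last by rewrite eval_cons.
    by rewrite mul0r add0r.
  by rewrite IHf !eval_cons mulrDl addrACA.
- by rewrite eval_cons IHf !eval_cons !addrA.
- by rewrite eval_cons IHg (eval_cons l) addrCA.
Qed.

Definition rows_hold (T : rows) :=
  forall k r, PositiveMap.find k T = Some r -> eval r = 0.

Lemma eval_reduce n T f : rows_hold T -> eval f = 0 -> eval (reduce n T f) = 0.
Proof.
move=> T_holds; elim: n f => [//|n IHn] [//|[k c] f] f0 /=.
case Tk: PositiveMap.find => [[|[l a] r]|//] //.
by apply: IHn; rewrite eval_add !eval_scale f0 (T_holds _ _ Tk) !mulr0 addr0.
Qed.

Lemma echelon_hold (A : eqType) (h : A -> lincomb) (s : seq A) :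
  {in s, forall a, eval (h a) = 0} -> rows_hold (echelon (map h s)).
Proof.
rewrite /echelon; set T := PositiveMap.empty _.
have: rows_hold T by move=> k r; rewrite PositiveMap.gempty.
elim: s T => [//|a s IHs] T T_holds s0 /=.
apply: IHs => [|c c_s]; last by apply: s0; rewrite inE c_s orbT.
rewrite /insert_row; have := eval_reduce 1000 T_holds (s0 a (mem_head _ _)).
case: reduce => [//|[k c] r] r0 l p.
have [->|lk] := Pos.eq_dec l k; first by rewrite PositiveMap.gss => -[<-].
by rewrite PositiveMap.gso //; apply: T_holds.
Qed.

Lemma all_In (A : Type) (P : A -> bool) (s : seq A) a :
  all P s -> List.In a s -> P a.
Proof. by elim: s => //= b s IHs /andP[Pb /IHs sP] [<-|/sP]. Qed.

(** Back substitution, from the largest unknown down: in the row of [k] all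
unknowns but [k] are already known to vanish. *)
Lemma triangular_zero M T k :
  triangular M T -> rows_hold T -> PositiveMap.mem k T -> x k = 0.
Proof.
move=> tri T_holds.
have [n] := ubnP (Pos.to_nat M - Pos.to_nat k).
elim: n k => // n IHn k; rewrite ltnS => k_n.
rewrite PositiveMap.mem_find; case Tk: PositiveMap.find => [r|] // _.
have := all_In tri (PositiveMap.elements_correct _ _ Tk).
case: r Tk => [//|[l a] r] Tk /=.
case/and4P=> [/Pos.eqb_spec l_k a0 /Pos.ltb_spec0 lM r_gt]; subst l.
have := T_holds _ _ Tk; rewrite eval_cons eval_zero ?addr0 => [/eqP|t t_r].
  by rewrite mulf_eq0 of_Z_eq0 (negPf a0) => /eqP.
have /andP[/Pos.ltb_spec0 lt Tt] := all_In r_gt t_r.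
by apply: IHn Tt; lia.
Qed.

End Solve.

(** * Words for the weights of the half-spin modules *)

Definition word := seq bool.

Fixpoint all_words n : seq word :=
  if n is n'.+1 then
    map (cons false) (all_words n') ++ map (cons true) (all_words n')
  else [:: [::]].

Definition words (b : bool) : seq word :=
  [seq w <- all_words 5 | odd (count id w) == b].

Lemma mem_all_words n w : (w \in all_words n) = (size w == n).
Proof.
elim: n w => [|n IHn] [|x w] //=; rewrite mem_cat.
  by apply/negbTE/norP; split; apply/mapP=> -[].
have mem_cons y z s : (y :: w \in map (cons z) s) = (y == z) && (w \in s).
  apply/mapP/andP=> [[v vs [-> ->]]|[/eqP-> ws]] //.
  by exists w.
by rewrite !mem_cons IHn eqSS; case: x; rewrite /= ?orbF.
Qed.

Lemma mem_words b w :
  (w \in words b) = (odd (count id w) == b) && (size w == 5).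
Proof. by rewrite mem_filter mem_all_words. Qed.

Lemma words_uniq b : uniq (words b).
Proof. by case: b. Qed.

Lemma words_size b w : w \in words b -> size w = 5.
Proof. by rewrite mem_words => /andP[_ /eqP]. Qed.

Definition wset (w : word) : {set 'I_5} := [set i : 'I_5 | nth false w i].

Definition flip (i : nat) (w : word) : word :=
  set_nth false w i (~~ nth false w i).

(** The parity of the number of basis vectors that e_i has to pass on its way
to its place in the product e_w. *)
Definition before (i : nat) (w : word) : bool := odd (count id (take i w)).

Definition Zsign (s : bool) : Z := if s then Zneg xH else Zpos xH.

Lemma wset_inj v w : size v = 5 -> size w = 5 -> wset v = wset w -> v = w.
Proof.
move=> sv sw /setP vw; apply: (@eq_from_nth _ false) => [|i];
  rewrite sv ?sw // => lti.
by have := vw (Ordinal lti); rewrite !inE.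
Qed.

Definition wordof (A : {set 'I_5}) : word := [seq i \in A | i <- enum 'I_5].

Lemma size_wordof A : size (wordof A) = 5.
Proof. by rewrite size_map size_enum_ord. Qed.

Lemma wordofK : cancel wordof wset.
Proof.
move=> A; apply/setP=> i; rewrite inE (nth_map i) ?size_enum_ord //.
by rewrite nth_ord_enum.
Qed.

Lemma card_ord_pred (p : pred nat) n :
  #|[set j : 'I_n | p j]| = count p (iota 0 n).
Proof.
rewrite cardsE -sum1_card -[n in iota 0 n]subn0 -/(index_iota 0 n) -sum1_count.
by rewrite big_mkord.
Qed.

Lemma odd_wset w : size w = 5 -> odd #|wset w| = odd (count id w).
Proof.
move=> sw; rewrite card_ord_pred; congr odd.
by rewrite -[in RHS](mkseq_nth false w) /mkseq count_map sw.
Qed.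

Section Spinors.
Variable F : numFieldType.
Local Notation Zr := (of_Z F).

Lemma of_Zsign s : Zr (Zsign s) = (-1) ^+ s.
Proof. by case: s. Qed.

Lemma spin_sign_word (i : 'I_5) w : size w = 5 ->
  spin_sign F i (wset w) = Zr (Zsign (before i w)).
Proof.
move=> sw; rewrite of_Zsign /before signr_odd /spin_sign; congr (_ ^+ _).
have -> : [set j in wset w | (j < i)%N] =
    [set j : 'I_5 | nth false w j && (j < i)%N].
  by apply/setP=> j; rewrite !inE.
rewrite (card_ord_pred (fun j => nth false w j && (j < i)%N)).
case: w sw => [|w0 [|w1 [|w2 [|w3 [|w4 []]]]]] //= _.
by case: i => -[|[|[|[|[|i]]]]] //= _; rewrite ?andbT ?andbF ?addn0.
Qed.

Lemma size_flip i w : (i < 5)%N -> size w = 5 -> size (flip i w) = 5.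
Proof. by move=> lti sw; rewrite size_set_nth sw; apply/maxn_idPr. Qed.

Lemma wset_flip (i : 'I_5) w :
  wset (flip i w) = if i \in wset w then wset w :\ i else i |: wset w.
Proof.
apply/setP=> j; rewrite inE /flip nth_set_nth /= inE.
rewrite (_ : (j == i :> nat) = (j == i)) //; case wi: (nth false w i);
  rewrite !inE; case: (eqVneq j i) => //= ->; by rewrite wi.
Qed.

Lemma gamma_word (x : bool * 'I_5) (s : spinor F) w : size w = 5 ->
  gamma F x s (wset w) =
    if nth false w x.2 == x.1 then
      Zr (Zsign (before x.2 w)) * s (wset (flip x.2 w))
    else 0.
Proof.
case: x => -[] i sw; rewrite /gamma /= lfunE ffunE wset_flip -spin_sign_word //;
  by rewrite inE; case: nth.
Qed.

(** * Coordinates of spinors *)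

Definition delta (w : word) : spinor F := [ffun A => (A == wset w)%:R].

Definition hdelta b (w : word) : half_spinor F b := half_out b (delta w).

(** The coordinate of a half spinor at a word: zero at a word of the wrong
parity, so that words need no proof of their parity. *)
Definition hcoord b (s : half_spinor F b) (w : word) : F := half_in s (wset w).

Lemma half_indexP b (u : half_index b) : wordof (val u) \in words b.
Proof.
rewrite mem_words size_wordof eqxx -odd_wset ?size_wordof // wordofK.
by rewrite (valP u).
Qed.

Lemma half_indexE b w : w \in words b ->
  exists u : half_index b, val u = wset w.
Proof.
rewrite mem_words => /andP[ow /eqP sw].
have ow' : odd #|wset w| == b by rewrite odd_wset.
by exists (Sub (wset w) ow'); rewrite SubK.
Qed.

Lemma hcoordE b (s : half_spinor F b) w (u : half_index b) :
  val u = wset w -> hcoord s w = s u.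
Proof. by move=> uw; rewrite /hcoord ffunE -uw valK. Qed.

Lemma hcoord_out b (s : spinor F) w : w \in words b ->
  hcoord (half_out b s) w = s (wset w).
Proof. by move=> /half_indexE[u uw]; rewrite (hcoordE _ uw) ffunE uw. Qed.

Lemma half_in_delta b w : w \in words b -> half_in (hdelta b w) = delta w.
Proof.
move=> wb; apply/ffunP=> A; have sv := size_wordof A; rewrite -(wordofK A).
set v := wordof A in sv *.
have [vb|vb] := boolP (v \in words b).
  by rewrite -[LHS]/(hcoord _ v) hcoord_out.
rewrite !ffunE insubN /=; last first.
  by move: vb; rewrite mem_words sv eqxx andbT odd_wset.
case: eqP => // /(wset_inj sv (words_size wb)) vw.
by rewrite vw wb in vb.
Qed.

Lemma hcoord_delta b c d : c \in words b -> d \in words b ->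
  hcoord (hdelta b c) d = (d == c)%:R.
Proof.
move=> cb db; rewrite hcoord_out // ffunE; congr (nat_of_bool _)%:R.
have [->|] := eqVneq d c; first by rewrite eqxx.
apply: contraNF => /eqP dc; apply/eqP.
by apply: wset_inj dc; [apply: words_size db | apply: words_size cb].
Qed.

Lemma std_basis_word b (u : half_index b) w :
  val u = wset w -> std_basis F u = hdelta b w.
Proof.
by move=> uw; apply/ffunP=> v; rewrite !ffunE -uw -(inj_eq val_inj).
Qed.

Lemma hcoordP b (s t : half_spinor F b) :
  {in words b, hcoord s =1 hcoord t} -> s = t.
Proof.
move=> st; apply/ffunP=> u.
have uw : val u = wset (wordof (val u)) by rewrite wordofK.
by rewrite -!(hcoordE _ uw) st // half_indexP.
Qed.

Lemma hcoordD b (s t : half_spinor F b) w :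
  hcoord (s + t) w = hcoord s w + hcoord t w.
Proof. by rewrite /hcoord linearD ffunE. Qed.

Lemma hcoordZ b a (s : half_spinor F b) w : hcoord (a *: s) w = a * hcoord s w.
Proof. by rewrite /hcoord linearZ ffunE. Qed.

(** The bridge between sums over the index type of the module, as in the
trace, and sums over the explicit list of words. *)
Lemma sum_half b (f : half_index b -> F) (g : word -> F) :
  (forall u w, val u = wset w -> f u = g w) ->
  \sum_u f u = \sum_(w <- words b) g w.
Proof.
move=> fg; have w_inj : injective (fun u : half_index b => wordof (val u)).
  by move=> u v /(can_inj wordofK)/val_inj.
pose ws := [seq wordof (val u) | u <- index_enum (half_index b)].
rewrite (@perm_big _ _ _ _ (words b) ws) /=.
  by rewrite big_map; apply: eq_bigr => u _; apply: fg; rewrite wordofK.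
rewrite perm_sym; apply: uniq_perm;
  rewrite ?words_uniq ?map_inj_uniq ?index_enum_uniq // => w.
apply/mapP/idP=> [[u _ ->]|wb]; first exact: half_indexP.
have [u uw] := half_indexE wb; exists u; rewrite ?mem_index_enum //.
by apply: wset_inj; rewrite ?size_wordof ?(words_size wb) // wordofK.
Qed.

Lemma hdelta_sum b (s : half_spinor F b) :
  s = \sum_(w <- words b) hcoord s w *: hdelta b w.
Proof.
apply: hcoordP => d db.
have hs : {morph (fun t => @hcoord b t d) : t u / t + u}.
  by move=> t u; rewrite hcoordD.
rewrite (big_morph _ hs (_ : hcoord 0 d = 0)); last first.
  by rewrite /hcoord linear0 ffunE.
rewrite (bigD1_seq d) ?words_uniq //= hcoordZ hcoord_delta // eqxx mulr1.
rewrite big1_seq ?addr0 // => w /andP[wd wb].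
by rewrite hcoordZ hcoord_delta // eq_sym (negPf wd) mulr0.
Qed.

Lemma lfun_words b (U : vectType F) (f g : 'Hom(half_spinor F b, U)) :
  {in words b, forall w, f (hdelta b w) = g (hdelta b w)} -> f = g.
Proof.
move=> fg; apply/lfunP=> s.
rewrite (hdelta_sum s) [LHS]linear_sum [RHS]linear_sum.
by apply: eq_big_seq => w wb; rewrite [LHS]linearZ [RHS]linearZ /= fg.
Qed.

End Spinors.

(** * The entries of the elements of C + spin(10) *)

(** The coefficient of e_d in gamma x (gamma y e_c), computed backwards from
[d] because [ext_mul] and [contract] are defined on coefficients. *)
Definition gamma2_entry (x y : bool * nat) (c d : word) : Z :=
  let d' := flip x.2 d in
  if [&& nth false d x.2 == x.1, nth false d' y.2 == y.1 & flip y.2 d' == c]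
  then Zsign (before x.2 d (+) before y.2 d') else Z0.

Definition commutator_entry (x y : bool * nat) (c d : word) : Z :=
  Z.sub (gamma2_entry x y c d) (gamma2_entry y x c d).

(** The parity of the number of ones of [c] strictly between the two places
where [c] and [d] differ. These are the basis vectors that the product of the
two gamma matrices passes once only, so they give the relative sign of the
entries of a root vector. *)
Fixpoint twist (inside : bool) (c d : word) : bool :=
  match c, d with
  | x :: c', y :: d' =>
    if x (+) y then twist (~~ inside) c' d'
    else (inside && x) (+) twist inside c' d'
  | _, _ => false
  end.

Definition changes (c d : word) : seq bool := [seq t.1 (+) t.2 | t <- zip c d].

(** The root leading from [c] to [d]: two bits for each place, telling whether
it changes and its new value if it does. Labels of roots have length 10, those
of Cartan elements length 5, and the label of the identity is empty. *)
Definition root_label (c d : word) : word :=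
  flatten [seq [:: t.1 (+) t.2; (t.1 (+) t.2) && t.2] | t <- zip c d].

Definition cartan_label (i : nat) : word := [seq j == i | j <- iota 0 5].

(** The entry from e_c to e_d of an element of the algebra, as a combination of
its coordinates: the i-th Cartan element is diagonal with eigenvalue 1 on the
words containing i and -1 on the others. *)
Definition entry_terms (c d : word) : seq (word * Z) :=
  match count id (changes c d) with
  | 0 => ([::], Zpos xH) ::
         [seq (cartan_label i, Zsign (~~ nth false c i)) | i <- iota 0 5]
  | 2 => [:: (root_label c d, Zsign (twist false c d))]
  | _ => [::]
  end.

(** The coordinates of the commutator of gamma x and gamma y, x and y being at
the places i and j. For i < j its entry from e_c to e_d is twice that of
gamma x gamma y, whose sign is (-1)^m, where m counts the ones of [d] at the
places i, ..., j - 1 plus one for the change at i; this is [twist] corrected by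
the new value at i. Exchanging x and y changes the sign. *)
Definition commutator_coef (x y : bool * nat) (l : word) : Z :=
  if x.2 == y.2 then
    if (x.1 != y.1) && (l == cartan_label x.2) then Zsign (~~ x.1) else Z0
  else if l == flatten [seq if k == x.2 then [:: true; x.1]
                            else if k == y.2 then [:: true; y.1]
                            else [:: false; false] | k <- iota 0 5]
  then Z.mul (Zpos (xO xH)) (Zsign (if (x.2 < y.2)%N then ~~ x.1 else y.1))
  else Z0.

Definition terms_sum (t : word -> Z) (c d : word) : Z :=
  foldr (fun l s => Z.add (Z.mul l.2 (t l.1)) s) Z0 (entry_terms c d).

Definition generators : seq (bool * nat) :=
  [seq (p, i) | p <- [:: true; false], i <- iota 0 5].

Definition commutator_coef_ok (b : bool) : bool :=
  all (fun c => all (fun d =>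
    Z.eqb (if d == c then Zpos xH else Z0)
          (terms_sum (fun l => if l == [::] then Zpos xH else Z0) c d) &&
    all (fun x => all (fun y =>
      Z.eqb (commutator_entry x y c d) (terms_sum (commutator_coef x y) c d))
    generators) generators) (words b)) (words b).

Lemma commutator_coefP b : commutator_coef_ok b.
Proof. by case: b; vm_compute. Qed.

Section Spin.
Variable F : numFieldType.
Local Notation Zr := (of_Z F).

Lemma of_ZN z : Zr (Z.opp z) = - Zr z.
Proof. by rewrite /of_Z -[Z.opp z]/(- z) !rmorphN. Qed.

Definition spin_gen b (x y : bool * 'I_5) : 'End(half_spinor F b) :=
  half_end b ((gamma F x \o gamma F y) - (gamma F y \o gamma F x))%VF.

Lemma gamma_gamma_word (x y : bool * 'I_5) c d : size c = 5 -> size d = 5 ->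
  gamma F x (gamma F y (delta F c)) (wset d) =
    Zr (gamma2_entry (x.1, val x.2) (y.1, val y.2) c d).
Proof.
move=> sc sd; have sf := size_flip (ltn_ord x.2) sd.
rewrite gamma_word // gamma_word // /gamma2_entry /=.
case: eqP => [_|//] /=; case: eqP => [_|_] /=; last by rewrite mulr0.
rewrite ffunE; have [<-|ne] := eqVneq (flip _ (flip _ _)) c.
  by rewrite eqxx mulr1 !of_Zsign signr_addb.
rewrite (_ : _ == _ = false) ?mulr0 //; apply: contraNF ne => /eqP e; apply/eqP.
by apply: wset_inj e => //; rewrite size_flip.
Qed.

Lemma spin_gen_word b x y c d : c \in words b -> d \in words b ->
  hcoord (spin_gen b x y (hdelta F b c)) d =
    Zr (commutator_entry (x.1, val x.2) (y.1, val y.2) c d).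
Proof.
move=> cb db; rewrite /spin_gen /half_end !comp_lfunE !lfunE /= half_in_delta //.
rewrite hcoord_out // opp_lfunE !comp_lfunE ffunE [X in _ + X]ffunE.
by rewrite !gamma_gamma_word ?(words_size cb) ?(words_size db) // -of_ZN -of_ZD.
Qed.

Lemma spin_gen_in b x y : spin_gen b x y \in cspin10 F b.
Proof.
rewrite /cspin10 memvE; apply: subv_trans (addvSr _ _); rewrite /spin10.
by rewrite (sumv_sup x) // (sumv_sup y).
Qed.

Lemma id_in_cspin b : \1%VF \in cspin10 F b.
Proof. by rewrite /cspin10 memvE addvSl. Qed.

Definition entries_from b (f : 'End(half_spinor F b)) (t : word -> F) :=
  {in words b &, forall c d,
    hcoord (f (hdelta F b c)) d = \sum_(l <- entry_terms c d) Zr l.2 * t l.1}.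

Lemma terms_sumE (t : word -> Z) c d :
  Zr (terms_sum t c d) = \sum_(l <- entry_terms c d) Zr l.2 * Zr (t l.1).
Proof.
rewrite /terms_sum; elim: (entry_terms c d) => [|l s IHs].
  by rewrite big_nil.
by rewrite big_cons /= of_ZD of_ZM IHs.
Qed.

(** The coordinates exist since they do for the generators of the algebra,
where this is a finite computation, and the entries are linear in them. *)
Lemma entries_fromP b f : f \in cspin10 F b -> exists t, entries_from f t.
Proof.
have ent0 : exists t, entries_from (0 : 'End(half_spinor F b)) t.
  exists (fun=> 0) => c d _ _; rewrite big1 => [|l _]; last by rewrite mulr0.
  by rewrite lfunE /hcoord linear0 ffunE.
have entD (h k : 'End(half_spinor F b)) : (exists t, entries_from h t) ->
    (exists t, entries_from k t) -> exists t, entries_from (h + k) t.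
  move=> [t ht] [u ku]; exists (fun l => t l + u l) => c d cb db.
  rewrite add_lfunE hcoordD ht // ku // -big_split /=.
  by apply: eq_bigr => l _; rewrite mulrDr.
have entZ a (h : 'End(half_spinor F b)) : (exists t, entries_from h t) ->
    exists t, entries_from (a *: h) t.
  move=> [t ht]; exists (fun l => a * t l) => c d cb db.
  rewrite scale_lfunE hcoordZ ht // mulr_sumr.
  by apply: eq_bigr => l _; rewrite mulrCA.
have ok := commutator_coefP b.
rewrite /cspin10 => /memv_addP[_ /vlineP[a ->] [h hS ->]]; apply: (entD).
  apply: (entZ); exists (fun l => Zr (if l == [::] then Zpos xH else Z0)).
  move=> c d cb db.
  have /allP/(_ c cb)/allP/(_ d db)/andP[/Z.eqb_spec e _] := ok.
  rewrite -(terms_sumE (fun l => if l == [::] then Zpos xH else Z0)) -e.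
  by rewrite id_lfunE hcoord_delta //; case: eqP.
move: hS; rewrite /spin10 => /memv_sumP[k kS ->].
apply: (big_ind (fun h => exists t, entries_from h t)) => [//|h1 h2|x _].
  exact: entD.
have /memv_sumP[m mS ->] := kS x isT.
apply: (big_ind (fun h => exists t, entries_from h t)) => [//|h1 h2|y _].
  exact: entD.
have /vlineP[a' ->] := mS y isT; apply: (entZ); rewrite -/(spin_gen b x y).
set x' := (x.1, val x.2); set y' := (y.1, val y.2).
exists (fun l => Zr (commutator_coef x' y' l)) => c d cb db.
have gen (z : bool * 'I_5) : (z.1, val z.2) \in generators.
  by apply/allpairsP; exists (z.1, val z.2); rewrite mem_iota /=; case: z => -[] i.
have /allP/(_ c cb)/allP/(_ d db)/andP[_] := ok.
move=> /allP/(_ _ (gen x))/allP/(_ _ (gen y))/Z.eqb_spec e.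
by rewrite -(terms_sumE (commutator_coef x' y')) -e spin_gen_word.
Qed.

End Spin.

(** * Irreducibility of the dual half-spin module *)

(** For [c] and [d] differing in two places, some commutator of gamma matrices
has a nonzero entry to e_c from e_d, and from no other basis vector. *)
Definition root_step_ok (b : bool) : bool :=
  all (fun c => all (fun d =>
    (count id (changes c d) == 2) ==>
    has (fun x => has (fun y =>
      all (fun w => Z.eqb (commutator_entry x y w c) Z0 (+) (w == d)) (words b))
    generators) generators)
  (words b)) (words b).

Lemma root_stepP b : root_step_ok b.
Proof. by case: b; vm_compute. Qed.

(** Any two weights are joined by two roots. *)
Definition two_steps_ok (b : bool) : bool :=
  all (fun c => all (fun d =>
    has (fun u => (count id (changes c u) == 2) &&
                  (count id (changes u d) == 2)) (words b))
  (words b)) (words b).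

Lemma two_stepsP b : two_steps_ok b.
Proof. by case: b; vm_compute. Qed.

Definition cartan_weight_ok (b : bool) : bool :=
  all (fun c => all (fun d => all (fun i =>
    Z.eqb (commutator_entry (true, i) (false, i) c d)
          (if d == c then Zsign (~~ nth false c i) else Z0))
  (iota 0 5)) (words b)) (words b).

Lemma cartan_weightP b : cartan_weight_ok b.
Proof. by case: b; vm_compute. Qed.

Section Irreducible.
Variable F : numFieldType.
Local Notation Zr := (of_Z F).
Variable b : bool.
Local Notation V := (half_spinor F b).
Local Notation e := (hdelta F b).

Lemma dual_word (p : 'Hom(V, F^o)) s :
  p s = \sum_(w <- words b) hcoord s w * p (e w).
Proof.
rewrite {1}(hdelta_sum s) linear_sum; apply: eq_bigr => w _.
by rewrite linearZ.
Qed.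

Lemma cartan_weight (i : 'I_5) w : w \in words b ->
  spin_gen F b (true, i) (false, i) (e w) = Zr (Zsign (~~ nth false w i)) *: e w.
Proof.
move=> wb; apply: hcoordP => d db.
rewrite spin_gen_word // hcoordZ hcoord_delta //=.
have /allP/(_ w wb)/allP/(_ d db)/allP/(_ (val i)) := cartan_weightP b.
rewrite mem_iota ltn_ord => /(_ isT)/Z.eqb_spec ->.
by case: eqP => _; rewrite ?mulr1 ?mulr0.
Qed.

(** From a nonzero p in N the Cartan elements cut out a multiple of one
coordinate function, and the root vectors move it to all the others. *)
Lemma dual_irreducible (N : 'Hom(V, F^o) -> Prop) p :
    (forall a q r, N q -> N r -> N (a *: q + r)) ->
    (forall q A, N q -> A \in cspin10 F b -> N (q \o A)%VF) ->
  N p -> p != 0 -> forall q, N q.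
Proof.
move=> Nlin Nact Np p0.
have N0 : N 0 by rewrite -(addNr p) -scaleN1r; apply: Nlin.
have NZ a q : N q -> N (a *: q).
  by move=> Nq; rewrite -[_ *: _]addr0; apply: Nlin.
pose dual c := exists2 q, N q & {in words b, forall w, q (e w) = (w == c)%:R}.
have [c cb pc] : exists2 c, c \in words b & p (e c) != 0.
  apply/hasP; apply: contraNT p0 => /hasPn pw; apply/eqP/lfun_words => w wb.
  by rewrite lfunE; apply/eqP; move: (pw w wb); rewrite negbK.
(* For the Cartan element H at place n, one of (1 + H) / 2 and (1 - H) / 2 is
   the projection onto the words that agree with c at n. *)
have proj n : (n <= 5)%N -> exists2 q, N q &
    {in words b, forall w, q (e w) = (take n w == take n c)%:R * p (e w)}.
  elim: n => [_|n IHn ltn5].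
    by exists p => // w _; rewrite !take0 eqxx mul1r.
  have [q Nq qE] := IHn (ltnW ltn5).
  pose H := spin_gen F b (true, Ordinal ltn5) (false, Ordinal ltn5).
  exists (2^-1 *: (Zr (Zsign (~~ nth false c n)) *: (q \o H)%VF + q)).
    apply: NZ; apply: Nlin => //; apply: Nact => //; exact: spin_gen_in.
  move=> w wb; rewrite scale_lfunE add_lfunE scale_lfunE comp_lfunE.
  rewrite cartan_weight // linearZ /= qE //.
  rewrite !(take_nth false) ?(words_size wb) ?(words_size cb) // eqseq_rcons !of_Zsign.
  case: (take n w == _) => /=; last by rewrite !mul0r !scaler0 addr0 scaler0.
  rewrite -![_ *: _]/(_ * _) !mul1r.
  by case: (nth false w n); case: (nth false c n) => /=; field.
have dual_c : dual c.
  have [q Nq qE] := proj 5 isT; exists ((p (e c))^-1 *: q); first exact: NZ.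
  move=> w wb; rewrite scale_lfunE qE //.
  rewrite !take_oversize ?(words_size wb) ?(words_size cb) //.
  case: eqP => [->|_]; last by rewrite mul0r scaler0.
  by rewrite mul1r -[_ *: _]/(_ * _) mulVf.
have step d d' : d \in words b -> d' \in words b ->
    count id (changes d d') == 2 -> dual d -> dual d'.
  move=> db d'b dd' [q Nq qE].
  have /allP/(_ d db)/allP/(_ d' d'b)/implyP/(_ dd') := root_stepP b.
  move=> /hasP[x /allpairsP[[x1 x2] [_ x2_5 xE]]] /hasP[y].
  move=> /allpairsP[[y1 y2] [_ y2_5 yE]] /allP zE; subst x y.
  rewrite !mem_iota /= in x2_5 y2_5.
  pose X := spin_gen F b (x1, Ordinal x2_5) (y1, Ordinal y2_5).
  pose z w := Zr (commutator_entry (x1, x2) (y1, y2) w d).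
  have XE w : w \in words b -> (q \o X)%VF (e w) = z w.
    move=> wb; rewrite comp_lfunE dual_word (bigD1_seq d) ?words_uniq //=.
    rewrite qE // eqxx mulr1 big1_seq ?addr0 ?spin_gen_word // => u /andP[ud ub].
    by rewrite qE // (negPf ud) mulr0.
  exists ((z d')^-1 *: (q \o X)%VF).
    by apply: NZ; apply: Nact => //; exact: spin_gen_in.
  move=> w wb; rewrite scale_lfunE XE // -[_ *: _]/(_ * _).
  have := zE w wb; rewrite -(of_Z_eq0 F) -/(z w).
  case: (w =P d') => [->|_] /=; rewrite ?addbT ?addbF => z0.
    by rewrite mulVf.
  by rewrite (eqP z0) mulr0.
have dual_all d : d \in words b -> dual d.
  move=> db; have /allP/(_ c cb)/allP/(_ d db) := two_stepsP b.
  case/hasP=> u ub /andP[cu ud].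
  by apply: (step u) => //; apply: (step c).
move=> q.
have sub s : {subset s <= words b} -> uniq s -> exists2 r, N r &
    {in words b, forall w, r (e w) = (w \in s)%:R * q (e w)}.
  elim: s => [_ _|d s IHs sb /= /andP[ds us]].
    by exists 0 => // w _; rewrite lfunE mul0r.
  have [|r Nr rE] := IHs _ us; first by move=> w ws; rewrite sb // inE ws orbT.
  have [q' Nq' q'E] := dual_all d (sb _ (mem_head _ _)).
  exists (q (e d) *: q' + r); first exact: Nlin.
  move=> w wb; rewrite add_lfunE scale_lfunE rE // q'E // inE.
  case: eqP => [->|_]; rewrite -[_ *: _]/(_ * _) /=; last by rewrite mulr0 add0r.
  by rewrite (negPf ds) mul0r addr0 mulrC.
have [r Nr rE] := sub _ (fun w wb => wb) (words_uniq b).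
by rewrite (_ : q = r) //; apply: lfun_words => w wb; rewrite rE // wb mul1r.
Qed.

End Irreducible.

(** * Linear systems for families of elements of C + spin(10) *)

Fixpoint pos_of_word (w : word) : positive :=
  if w is x :: w' then (if x then xI else xO) (pos_of_word w') else xH.

Fixpoint word_of_pos (p : positive) : word :=
  match p with
  | xH => [::]
  | xO p' => false :: word_of_pos p'
  | xI p' => true :: word_of_pos p'
  end.

Lemma pos_of_wordK : cancel pos_of_word word_of_pos.
Proof. by elim=> //= -[] w /= ->. Qed.

Fixpoint ltw (v w : word) : bool :=
  match v, w with
  | x :: v', y :: w' => if x == y then ltw v' w' else y
  | _, _ => false
  end.

Definition sort_form (f : lincomb) : lincomb :=
  foldr (fun t => add_form [:: t]) [::] f.

(** The coordinate with label [l] of the member (u, v) of a family. *)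
Definition unknown (u v l : word) : positive := pos_of_word (u ++ v ++ l).

(** The entry (c, d) of the member (u, v) of a family Y with
Y v u = (-1)^s Y u v, through the unknowns of the pairs in increasing order;
for s = 1 the member (u, u) vanishes. *)
Definition entry_form (s : bool) (u v c d : word) : lincomb :=
  sort_form
    (if u == v then
       if s then [::] else [seq (unknown u v l.1, l.2) | l <- entry_terms c d]
     else if ltw u v then [seq (unknown u v l.1, l.2) | l <- entry_terms c d]
     else [seq (unknown v u l.1, Z.mul (Zsign s) l.2) | l <- entry_terms c d]).

(** A list of terms (z, (u, v, c, d)) stands for the equation that the sum of
the z Y(u, v)_(c, d) is zero, Y(u, v)_(c, d) being the coefficient of e_d in
Y(u, v) e_c. *)
Definition equation := seq (Z * (word * word * word * word)).

Definition equation_form (s : bool) (q : equation) : lincomb :=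
  foldr (fun t => let: (z, (u, v, c, d)) := t in
           add_form (scale_form z (entry_form s u v c d))) [::] q.

(** An unknown uses two words of length 5 and a label of length at most 10, so
its number has at most 21 bits and the bound 2 ^ 30 is never reached. *)
Definition determined (b s : bool) (qs : seq equation) : bool :=
  let T := echelon (map (equation_form s) qs) in
  let ws := words b in
  triangular (pos_of_word (nseq 30 false)) T &&
  all (fun u => all (fun v => all (fun c => all (fun d =>
    all (fun t => PositiveMap.mem t.1 T) (entry_form s u v c d)) ws) ws) ws) ws.

Section Families.
Variables (F : numFieldType) (b s : bool).
Variable Y : word -> word -> 'End(half_spinor F b).
Local Notation Zr := (of_Z F).
Local Notation e := (hdelta F b).

Definition holds (q : equation) :=
  \sum_(t <- q)
    (let: (z, (u, v, c, d)) := t in Zr z * hcoord (Y u v (e c)) d) = 0.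

Definition over_words (q : equation) := forall z u v c d,
  (z, (u, v, c, d)) \in q ->
  [/\ u \in words b, v \in words b, c \in words b & d \in words b].

Hypothesis Y_in : {in words b &, forall u v, Y u v \in cspin10 F b}.
Hypothesis Y_sym : {in words b &, forall u v, Y u v = (-1) ^+ s *: Y v u}.

(** Elimination makes all unknowns vanish, hence all entries of the family. *)
Lemma determined_zero (qs : seq equation) :
    determined b s qs -> {in qs, forall q, over_words q /\ holds q} ->
  {in words b &, forall u v, Y u v = 0}.
Proof.
move=> /andP[tri mem_T] qsP.
have [t tP] : exists t : word * word -> word -> F, forall uv,
    uv.1 \in words b -> uv.2 \in words b -> entries_from (Y uv.1 uv.2) (t uv).
  suff /choice[t tP] : forall uv, exists t,
      uv.1 \in words b -> uv.2 \in words b -> entries_from (Y uv.1 uv.2) t.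
    by exists t.
  move=> [u v]; have [ub|] := boolP (u \in words b); last by exists (fun=> 0).
  have [vb|] := boolP (v \in words b); last by exists (fun=> 0).
  by have [t tP] := entries_fromP (Y_in ub vb); exists t.
pose x p := let w := word_of_pos p in
  t (take 5 w, take 5 (drop 5 w)) (drop 10 w).
have xE u v l : u \in words b -> v \in words b -> x (unknown u v l) = t (u, v) l.
  move=> /words_size su /words_size sv.
  rewrite /x /unknown pos_of_wordK take_size_cat // drop_size_cat //.
  by rewrite take_size_cat // catA drop_size_cat // size_cat su sv.
have sortE f : eval x (sort_form f) = eval x f.
  elim: f => [//|[k z] f IHf]; rewrite [LHS]eval_add IHf !eval_cons.
  by rewrite [eval x [::]]big_nil addr0.
have formE u v c d :
    u \in words b -> v \in words b -> c \in words b -> d \in words b ->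
    eval x (entry_form s u v c d) = hcoord (Y u v (e c)) d.
  move=> ub vb cb db; rewrite /entry_form sortE.
  have direct u' v' : u' \in words b -> v' \in words b ->
      eval x [seq (unknown u' v' l.1, l.2) | l <- entry_terms c d] =
        hcoord (Y u' v' (e c)) d.
    move=> u'b v'b; rewrite (tP (u', v')) // /eval big_map.
    by apply: eq_bigr => l _; rewrite xE.
  case: eqP => [->|_].
    case ss: s; last exact: direct.
    have /eqP := Y_sym vb vb; rewrite ss scaleN1r -addr_eq0 -mulr2n.
    rewrite -scaler_nat scaler_eq0 pnatr_eq0 /= => /eqP->.
    by rewrite lfunE /hcoord linear0 ffunE [LHS]big_nil.
  case: ltw; first exact: direct.
  rewrite Y_sym // scale_lfunE hcoordZ -direct // /eval !big_map mulr_sumr.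
  by apply: eq_bigr => l _; rewrite of_ZM of_Zsign mulrA.
have eqE q : over_words q -> holds q -> eval x (equation_form s q) = 0.
  rewrite /holds => qb <-; elim: q qb => [_|[z [[[u v] c] d]] q IHq qb].
    by rewrite /eval !big_nil.
  have [ub vb cb db] := qb _ _ _ _ _ (mem_head _ _).
  rewrite big_cons [LHS]eval_add eval_scale formE // IHq // => z' u' v' c' d' q'.
  by apply: (qb z'); rewrite inE q' orbT.
have T_holds := echelon_hold (fun q qin => eqE q (qsP q qin).1 (qsP q qin).2).
move=> u v ub vb; apply: lfun_words => c cb; rewrite zero_lfunE.
apply: hcoordP => d db; rewrite -formE // /hcoord linear0 ffunE.
have {}mem_T := allP (allP (allP (allP mem_T u ub) v vb) c cb) d db.
by apply: eval_zero => k /(all_In mem_T); apply: triangular_zero tri T_holds.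
Qed.

End Families.

Fixpoint triples (ws : seq word) : seq (word * word * word) :=
  if ws is u :: ws' then
    [seq (u, v, w) | v <- ws', w <- ws'] ++ triples ws'
  else [::].

Definition bianchi_equation (u v w d : word) : equation :=
  [:: (Zpos xH, (u, v, w, d)); (Zpos xH, (v, w, u, d));
      (Zpos xH, (w, u, v, d))].

(** The Bianchi sum is alternating, so increasing words [u], [v], [w] suffice;
[words b] is increasing, and the filter selects [v] before [w]. *)
Definition bianchi_equations (b : bool) : seq equation :=
  [seq bianchi_equation t.1.1 t.1.2 t.2 d |
     t <- filter (fun t => ltw t.1.2 t.2) (triples (words b)), d <- words b].

Definition ricci_equation (b : bool) (v w : word) : equation :=
  [seq (Zpos xH, (u, v, w, u)) | u <- words b].

Definition ricci_equations (b : bool) : seq equation :=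
  [seq ricci_equation b v w | v <- words b, w <- words b].

Definition symmetry_equation (u v w d : word) : equation :=
  [:: (Zpos xH, (u, v, w, d)); (Zneg xH, (u, w, v, d))].

Definition symmetry_equations (b : bool) : seq equation :=
  [seq symmetry_equation t.1 t.2.1 t.2.2 d |
     t <- filter (fun t => ltw t.2.1 t.2.2)
       [seq (u, vw) | u <- words b,
                      vw <- [seq (v, w) | v <- words b, w <- words b]],
     d <- words b].

Lemma curvature_determined b :
  determined b true (bianchi_equations b ++ ricci_equations b).
Proof. by case: b; vm_compute. Qed.

Lemma prolongation_determined b : determined b false (symmetry_equations b).
Proof. by case: b; vm_compute. Qed.

Section Vanishing.
Variables (F : numFieldType) (b : bool).
Variable Y : word -> word -> 'End(half_spinor F b).
Local Notation e := (hdelta F b).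
Hypothesis Y_in : {in words b &, forall u v, Y u v \in cspin10 F b}.

Lemma mem_triples (ws : seq word) t : t \in triples ws ->
  [/\ t.1.1 \in ws, t.1.2 \in ws & t.2 \in ws].
Proof.
elim: ws => [//|u ws IHws] /=; rewrite mem_cat => /orP[|/IHws[??]?].
  by case/allpairsP=> -[v w] [/= vs wws ->] /=; rewrite !inE eqxx vs wws !orbT.
by rewrite !inE; split; apply/orP; right.
Qed.

(** The Bianchi equations have rank 5520 - 256 = 5264, and the 256 Ricci
equations bring the rank to the number of unknowns. *)
Lemma ricci_flat_zero :
    {in words b &, forall u v, Y u v = - Y v u} ->
    {in words b & &,
      forall u v w, Y u v (e w) + Y v w (e u) + Y w u (e v) = 0} ->
    {in words b &,
      forall v w, \sum_(u <- words b) hcoord (Y u v (e w)) u = 0} ->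
  {in words b &, forall u v, Y u v = 0}.
Proof.
move=> Yalt bianchi ricci.
apply: (determined_zero Y_in _ (curvature_determined b)) => [u v ub vb|q].
  by rewrite scaleN1r Yalt.
rewrite mem_cat => /orP[] /allpairsP[].
  move=> [[[u v] w] d] [/=]; rewrite mem_filter.
  move=> /andP[_ /mem_triples[/= ub vb wb]] db ->; split; last first.
    rewrite /holds !big_cons big_nil addr0 !mul1r addrA -!hcoordD bianchi //.
    by rewrite /hcoord linear0 ffunE.
  by move=> z u' v' c' d'; rewrite !inE => /or3P[] /eqP[_ -> -> -> ->].
move=> [v w] [/= vb wb ->]; split.
  by move=> z u' v' c' d' /mapP[u ub [_ -> -> -> ->]].
rewrite /holds big_map -[RHS](ricci v w) //.
by apply: eq_bigr => u _; rewrite mul1r.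
Qed.

(** Here the 30720 symmetry equations alone have rank 6256. *)
Lemma second_prolongation_zero :
    {in words b &, forall u v, Y u v = Y v u} ->
    {in words b & &, forall u v w, Y u v (e w) = Y u w (e v)} ->
  {in words b &, forall u v, Y u v = 0}.
Proof.
move=> Ysym Yprol.
apply: (determined_zero Y_in _ (prolongation_determined b)) => [u v ub vb|q].
  by rewrite scale1r Ysym.
case/allpairsP=> -[[u [v w]] d] [/=]; rewrite mem_filter => /andP[_].
case/allpairsP=> -[u' vw] [/= ub /allpairsP[[v' w'] [/= vb wb ->]]].
move=> [-> -> ->] db ->.
split; first by move=> z ? ? ? ?; rewrite !inE => /orP[] /eqP[_ -> -> -> ->].
rewrite /holds !big_cons big_nil addr0 Yprol // -mulrDl.
by rewrite (_ : _ + _ = 0) ?mul0r // /of_Z /= addrN.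
Qed.

End Vanishing.

(** * Forms with two arguments *)

Section TwoForms.
Variables (F : fieldType) (V E : vectType F) (U : {vspace E}).

Lemma tuple1E (v : 1.-tuple V) : v = [tuple tnth v ord0].
Proof. by apply/eq_from_tnth=> i; rewrite ord1. Qed.

Lemma tuple2E (v : 2.-tuple V) : v = [tuple tnth v ord0; tnth v ord_max].
Proof.
apply/eq_from_tnth=> i; case: (unliftP ord0 i) => [j|] -> //.
by rewrite ord1; congr tnth; apply: val_inj.
Qed.

Lemma set_arg2_0 (u v x : V) : set_arg [tuple u; v] ord0 x = [tuple x; v].
Proof. by apply/eq_from_tnth=> -[[|[|]]] // i; rewrite tnth_mktuple. Qed.

Lemma set_arg2_1 (u v x : V) : set_arg [tuple u; v] ord_max x = [tuple u; x].
Proof. by apply/eq_from_tnth=> -[[|[|]]] // i; rewrite tnth_mktuple. Qed.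

Lemma wedge2_linearr (psi : 2.-tuple V -> E) u : wedge U psi ->
  linear (fun v => psi [tuple u; v]).
Proof.
case=> lin _ _ a x y; have := lin [tuple u; 0] ord_max a x y.
by rewrite !set_arg2_1.
Qed.

Lemma wedge2_linearl (psi : 2.-tuple V -> E) v : wedge U psi ->
  linear (fun u => psi [tuple u; v]).
Proof.
case=> lin _ _ a x y; have := lin [tuple 0; v] ord0 a x y.
by rewrite !set_arg2_0.
Qed.

Lemma wedge2_alt (psi : 2.-tuple V -> E) u : wedge U psi -> psi [tuple u; u] = 0.
Proof. by case=> _ alt _; apply: (alt _ ord0 ord_max). Qed.

Lemma wedge2_anti (psi : 2.-tuple V -> E) u v : wedge U psi ->
  psi [tuple u; v] = - psi [tuple v; u].
Proof.
move=> w; apply/eqP; rewrite -addr_eq0; apply/eqP.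
have := wedge2_alt (u + v) w.
have linl x y z : psi [tuple x + y; z] = psi [tuple x; z] + psi [tuple y; z].
  by have := wedge2_linearl z w 1 x y; rewrite !scale1r.
have linr x y z : psi [tuple z; x + y] = psi [tuple z; x] + psi [tuple z; y].
  by have := wedge2_linearr z w 1 x y; rewrite !scale1r.
by rewrite linl !linr !wedge2_alt // add0r addr0.
Qed.

Lemma wedge2I (psi : 2.-tuple V -> E) (B : V -> V -> E) :
  (forall v, psi v = B (tnth v ord0) (tnth v ord_max)) ->
  (forall v, linear (B^~ v)) -> (forall u, linear (B u)) ->
  (forall u, B u u = 0) -> (forall u v, B u v \in U) -> wedge U psi.
Proof.
move=> psiE linl linr alt inU.
split=> [v i a x y|v i j ij vij|v]; last by rewrite psiE.
  rewrite !psiE !tnth_mktuple; case: (unliftP ord0 i) => [j|] -> //=.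
    by rewrite ord1 /= linr.
  by rewrite linl.
rewrite psiE; suff -> : tnth v ord0 = tnth v ord_max by [].
by move: i j ij vij => [[|[|]] //= i] [[|[|]] //= j] _; rewrite !(tnth_nth 0) /=.
Qed.

End TwoForms.

(** * Brackets in a one-graded Lie algebra *)

Section OneGraded.
Variables (F : fieldType) (V : vectType F) (g : {vspace 'End(V)}).
Variable br : graded g -> graded g -> graded g.
Hypotheses (lie : is_lie_bracket br) (gr : one_grading br).

Local Notation "[ x , y ]" := (br x y) (at level 0, format "[ x ,  y ]").
Local Notation m1 := (in_deg_m1 g).
Local Notation d0 := (@in_deg0 F V g).
Local Notation d1 := (@in_deg1 F V g).

Lemma brDl x y z : [x + y, z] = [x, z] + [y, z].
Proof. by have := lie_linearl lie 1 x y z; rewrite !scale1r. Qed.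

Lemma brDr x y z : [z, x + y] = [z, x] + [z, y].
Proof. by have := lie_linearr lie 1 x y z; rewrite !scale1r. Qed.

Lemma br0l z : [0, z] = 0.
Proof. by apply: (addrI [0, z]); rewrite -brDl !addr0. Qed.

Lemma br0r z : [z, 0] = 0.
Proof. by apply: (addrI [z, 0]); rewrite -brDr !addr0. Qed.

Lemma brNr x z : [z, - x] = - [z, x].
Proof. by apply: (addrI [z, x]); rewrite -brDr !addrN br0r. Qed.

Lemma brC x y : [x, y] = - [y, x].
Proof.
apply/eqP; rewrite -addr_eq0; have := lie_alt lie (x + y).
by rewrite brDl !brDr !(lie_alt lie) add0r addr0 => ->.
Qed.

Definition deg0_part (x : graded g) : 'End(V) := vsval x.1.2.

Lemma deg0_part_linear : linear deg0_part.
Proof. by move=> a [[v A] p] [[w B] q]; apply: linearP. Qed.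

Lemma deg0P x : x \in deg0 g -> x = d0 x.1.2.
Proof. by case/memv_imgP=> A _ ->; rewrite lfunE. Qed.

(** The element of g written T(v, p) above. *)
Definition pairing (v : V) (p : 'Hom(V, F^o)) : 'End(V) :=
  deg0_part [m1 v, d1 p].

Lemma pairing_in v p : pairing v p \in g.
Proof. exact: subvsP. Qed.

Lemma br_m1_d1 v p : [m1 v, d1 p] = d0 [m1 v, d1 p].1.2.
Proof. exact/deg0P/grading_m1_1. Qed.

Lemma pairing_linearl p : linear (pairing^~ p).
Proof.
move=> a x y; rewrite /pairing in_deg_m1_linear (lie_linearl lie).
exact: deg0_part_linear.
Qed.

Lemma pairing_linearr v : linear (pairing v).
Proof.
move=> a x y; rewrite /pairing in_deg1_linear (lie_linearr lie).
exact: deg0_part_linear.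
Qed.

Lemma m1_inj : injective m1.
Proof. by move=> v w []. Qed.

(** The Jacobi identity for u, v in V and p in V^*, as [u, v] = 0. *)
Lemma pairing_sym u v p : pairing u p v = pairing v p u.
Proof.
have := lie_jacobi lie (m1 u) (m1 v) (d1 p).
rewrite (grading_m1_m1 gr) br0r addr0 (brC (d1 p)) brNr.
rewrite (br_m1_d1 u) (br_m1_d1 v) !(grading_m1_0 gr).
by move/eqP; rewrite subr_eq0 => /eqP/m1_inj.
Qed.

(** The Jacobi identity for v, A and p, where [A, p] is p \o A. *)
Lemma pairing_eq0_act p A : A \in g -> (forall v, pairing v p = 0) ->
  forall v, pairing v (p \o A)%VF = 0.
Proof.
move=> gA p0 v; have br0 w : [m1 w, d1 p] = 0.
  rewrite br_m1_d1 (_ : _.1.2 = 0) ?linear0 //; exact/val_inj/p0.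
have := lie_jacobi lie (m1 v) (d0 (Subvs gA)) (d1 p).
rewrite (grading_0_1 gr) (grading_m1_0 gr) !(brC (d1 p)) !br0 oppr0 br0r !addr0.
by rewrite /pairing /= => ->.
Qed.

Lemma gradedE (x : graded g) : x = m1 x.1.1 + d0 x.1.2 + d1 x.2.
Proof.
by case: x => -[v A] p; congr (_, _, _); rewrite /= ?addr0 ?add0r.
Qed.

Lemma deg0_part_comm A B :
  deg0_part [d0 A, d0 B] = ((vsval B \o vsval A) - (vsval A \o vsval B))%VF.
Proof.
apply/lfunP=> v; rewrite add_lfunE opp_lfunE !comp_lfunE.
have := lie_jacobi lie (m1 v) (d0 A) (d0 B).
have -> : [d0 A, d0 B] = d0 [d0 A, d0 B].1.2 by apply/deg0P/grading_0_0.
rewrite (brC (d0 B) (m1 v)) brNr !(grading_m1_0 gr).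
rewrite !(brC (d0 _) (m1 _)) !(grading_m1_0 gr) opprK.
move/(congr1 (fun x : graded g => x.1.1)) => /= /eqP.
by rewrite -addrA addr_eq0 opprB => /eqP.
Qed.

Lemma deg0_part_br x y : deg0_part [x, y] =
  ((vsval y.1.2 \o vsval x.1.2) - (vsval x.1.2 \o vsval y.1.2))%VF
    + pairing x.1.1 y.2 - pairing y.1.1 x.2.
Proof.
have D u v : deg0_part (u + v) = deg0_part u + deg0_part v.
  by rewrite /deg0_part linearD.
have N u : deg0_part (- u) = - deg0_part u by rewrite /deg0_part linearN.
have Z1 v : deg0_part (m1 v) = 0 by rewrite /deg0_part linear0.
have Z0 : deg0_part 0 = 0 by rewrite -(Z1 0) linear0.
have Z2 p : deg0_part (d1 p) = 0 by rewrite /deg0_part linear0.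
have m1d0 A v : deg0_part [m1 v, d0 A] = 0 by rewrite (grading_m1_0 gr) Z1.
have d0m1 A v : deg0_part [d0 A, m1 v] = 0 by rewrite brC N m1d0 oppr0.
have d0d1 A p : deg0_part [d0 A, d1 p] = 0 by rewrite (grading_0_1 gr) Z2.
have d1d0 A p : deg0_part [d1 p, d0 A] = 0 by rewrite brC N d0d1 oppr0.
rewrite [in LHS](gradedE x) [in LHS](gradedE y) !brDl !brDr !D.
rewrite (grading_m1_m1 gr) (grading_1_1 gr) (brC (d1 _) (m1 _)) N.
rewrite !(d0m1, m1d0, d0d1, d1d0).
by rewrite deg0_part_comm !Z0 !(addr0, add0r) [X in X + _]addrC.
Qed.

End OneGraded.

(** * Cocycles and coboundaries *)

Section Cocycles.
Variables (F : fieldType) (V : vectType F) (g : {vspace 'End(V)}).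
Variable br : graded g -> graded g -> graded g.
Hypotheses (lie : is_lie_bracket br) (gr : one_grading br).

Local Notation "[ x , y ]" := (br x y) (at level 0, format "[ x ,  y ]").
Local Notation m1 := (in_deg_m1 g).
Local Notation d0 := (@in_deg0 F V g).
Local Notation d1 := (@in_deg1 F V g).

Lemma d_Lie1 (phi : 1.-tuple V -> graded g) u v :
  d_Lie br m1 phi [tuple u; v] = [m1 u, phi [tuple v]] - [m1 v, phi [tuple u]].
Proof.
rewrite /d_Lie !big_ord_recl big_ord0 addr0 expr0 expr1 scale1r scaleN1r.
have -> : omit_arg [tuple u; v] ord0 = [tuple v].
  by apply/eq_from_tnth=> -[[|]] // i; rewrite tnth_mktuple.
have -> // : omit_arg [tuple u; v] (lift ord0 ord0) = [tuple u].
by apply/eq_from_tnth=> -[[|]] // i; rewrite tnth_mktuple.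
Qed.

Lemma d_Lie2 (psi : 2.-tuple V -> graded g) u v w :
  d_Lie br m1 psi [tuple u; v; w] =
    [m1 u, psi [tuple v; w]] - [m1 v, psi [tuple u; w]]
      + [m1 w, psi [tuple u; v]].
Proof.
rewrite /d_Lie !big_ord_recl big_ord0 addr0 expr0 expr1 sqrrN expr1n.
rewrite !scale1r scaleN1r.
have -> : omit_arg [tuple u; v; w] ord0 = [tuple v; w].
  by apply/eq_from_tnth=> -[[|[|]]] // i; rewrite tnth_mktuple.
have -> : omit_arg [tuple u; v; w] (lift ord0 ord0) = [tuple u; w].
  by apply/eq_from_tnth=> -[[|[|]]] // i; rewrite tnth_mktuple.
have -> : omit_arg [tuple u; v; w] (lift ord0 (lift ord0 ord0)) = [tuple u; v].
  by apply/eq_from_tnth=> -[[|[|]]] // i; rewrite tnth_mktuple.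
by rewrite addrA.
Qed.

Lemma tuple3E (t : 3.-tuple V) : exists u v w, t = [tuple u; v; w].
Proof.
case: t => -[|u [|v [|w []]]] // i; exists u, v, w; exact: val_inj.
Qed.

(** As [v, A] = A v for A in g, the differential of a form with values in
degree 0 is its Bianchi sum. *)
Lemma cocycle_bianchi (psi : 2.-tuple V -> graded g) :
    wedge (deg0 g) psi -> d_Lie br m1 psi =1 (fun=> 0) ->
  wedge g (fun t => deg0_part (psi t)) /\
  forall u v w, deg0_part (psi [tuple u; v]) w + deg0_part (psi [tuple v; w]) u
    + deg0_part (psi [tuple w; u]) v = 0.
Proof.
move=> wpsi dpsi; have [lin alt in0] := wpsi; split.
  split=> [v i a x y|v i j ij vij|v]; last exact: subvsP.
    by rewrite lin deg0_part_linear.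
  by rewrite (alt _ _ _ ij vij) /deg0_part linear0.
move=> u v w; have := dpsi [tuple u; v; w]; rewrite d_Lie2.
have psiE t : psi t = d0 (psi t).1.2 by apply/deg0P/in0.
rewrite (wedge2_anti w u wpsi) (psiE [tuple u; v]) (psiE [tuple v; w]).
rewrite (psiE [tuple u; w]) !(grading_m1_0 gr).
move/(congr1 (fun x : graded g => x.1.1)) => /= <-.
by rewrite opp_lfunE -addrA addrC.
Qed.

(** As [u, v] = 0, the double bracket [u, [v, x]] is symmetric in u and v, so
the six terms of the second differential cancel in pairs. *)
Lemma coboundary_cocycle (phi : 1.-tuple V -> graded g)
    (psi : 2.-tuple V -> graded g) :
    wedge (deg1 g) phi -> psi =1 d_Lie br m1 phi ->
  wedge (deg0 g) psi /\ d_Lie br m1 psi =1 (fun=> 0).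
Proof.
move=> [lin _ in1] psiE.
have phiE t : phi t = d1 (phi t).2.
  by have /memv_imgP[p _ ->] := in1 t; rewrite lfunE.
have phi_lin : linear (fun u => phi [tuple u]).
  move=> a x y; have := lin [tuple 0] ord0 a x y.
  have set1 z : set_arg [tuple 0] ord0 z = [tuple z].
    by rewrite [LHS]tuple1E tnth_mktuple.
  by rewrite !set1.
have m1C u v x : [m1 u, [m1 v, x]] = [m1 v, [m1 u, x]].
  have := lie_jacobi lie (m1 u) (m1 v) x.
  rewrite (grading_m1_m1 gr) (br0r lie) addr0 (brC lie x) (brNr lie) => /eqP.
  by rewrite subr_eq0 => /eqP.
split; last first.
  move=> t; have [u [v [w ->]]] := tuple3E t.
  rewrite d_Lie2 !psiE !d_Lie1 !(brDr lie) !(brNr lie).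
  rewrite (m1C v u) (m1C w u) (m1C w v).
  by rewrite opprB [X in X + _]addrC !subrKA subrr.
pose B u v := [m1 u, phi [tuple v]] - [m1 v, phi [tuple u]].
apply: (wedge2I (B := B)); rewrite /B.
- by move=> v; rewrite psiE {1}[v]tuple2E d_Lie1.
- move=> v a x y; rewrite phi_lin in_deg_m1_linear (lie_linearl lie).
  by rewrite (lie_linearr lie) scalerBr opprD addrACA.
- move=> v a x y; rewrite phi_lin in_deg_m1_linear (lie_linearl lie).
  by rewrite (lie_linearr lie) scalerBr opprD addrACA.
- by move=> u; rewrite subrr.
by move=> u v; rewrite rpredB // phiE (grading_m1_1 gr).
Qed.

End Cocycles.

(** * Bases, traces and Ricci traces *)

Section Basis.
Variables (F : fieldType) (I : finType).
Local Notation V := {ffun I -> F^o}.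
Local Notation e := (std_basis F).

Definition second_prolongation_trivial (g : {vspace 'End(V)}) :=
  forall Q : V -> V -> 'End(V),
    (forall u v, Q u v \in g) ->
    (forall v, linear (Q^~ v)) -> (forall u, linear (Q u)) ->
    (forall u v, Q u v = Q v u) -> (forall u v w, Q u v w = Q u w v) ->
  forall u v, Q u v = 0.

Lemma std_basis_sum (v : V) : v = \sum_i v i *: e i.
Proof.
apply/ffunP=> j; rewrite sum_ffunE (bigD1 j) //= !ffunE eqxx -[_ *: _]/(_ * _).
rewrite mulr1 big1 ?addr0 // => i ij.
by rewrite !ffunE eq_sym (negPf ij) scaler0.
Qed.

Lemma linear_std_basis (W : vectType F) (f : V -> W) :
  linear f -> (forall i, f (e i) = 0) -> forall v, f v = 0.
Proof.
move=> lin f0 v; have D x y : f (x + y) = f x + f y.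
  by have := lin 1 x y; rewrite !scale1r.
have f00 : f 0 = 0 by apply: (addrI (f 0)); rewrite -D !addr0.
rewrite (std_basis_sum v) (big_morph f D f00) big1 // => i _.
by rewrite -[_ *: _]addr0 lin f0 f00 scaler0 addr0.
Qed.

Definition coord_fun (j : I) (v : V) : F^o := v j.

Lemma coord_fun_linear j : linear (coord_fun j).
Proof. by move=> a x y; rewrite /coord_fun !ffunE. Qed.

HB.instance Definition _ j := GRing.isLinear.Build F V F^o *:%R
  (coord_fun j) (coord_fun_linear j).

Lemma coord_lfunE j v : linfun (coord_fun j) v = v j.
Proof. by rewrite lfunE. Qed.

(** The map V -> V^* with matrix [m]; matrices replace bilinear forms so that
the Ricci trace of a differential becomes an endomorphism. *)
Definition dual_map (m : {ffun I * I -> F^o}) (v : V) : 'Hom(V, F^o) :=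
  \sum_i \sum_j (m (i, j) * v i) *: linfun (coord_fun j).

Lemma dual_map_linear m : linear (dual_map m).
Proof.
move=> a x y; rewrite /dual_map scaler_sumr -big_split /=; apply: eq_bigr => i _.
rewrite scaler_sumr -big_split /=; apply: eq_bigr => j _.
by rewrite !ffunE scalerA -scalerDl mulrDr [a *: _]/(a * _) mulrCA.
Qed.

Lemma dual_map_linearl v : linear (dual_map^~ v).
Proof.
move=> a m n; rewrite /dual_map scaler_sumr -big_split /=; apply: eq_bigr => i _.
rewrite scaler_sumr -big_split /=; apply: eq_bigr => j _.
by rewrite !ffunE scalerA -scalerDl mulrDl mulrA.
Qed.

Lemma dual_mapE m i j : dual_map m (e i) (e j) = m (i, j).
Proof.
rewrite /dual_map sum_lfunE (bigD1 i) //= sum_lfunE (bigD1 j) //=.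
rewrite scale_lfunE coord_lfunE !ffunE !eqxx -[_ *: _]/(_ * _) !mulr1.
rewrite big1 => [|k kj]; last first.
  by rewrite scale_lfunE coord_lfunE !ffunE (negPf kj) scaler0.
rewrite big1 ?addr0 // => k ki; rewrite sum_lfunE big1 // => l _.
by rewrite scale_lfunE !ffunE (negPf ki) mulr0 scale0r.
Qed.

Lemma trace_linear : linear (fun f : 'End(V) => trace f : F^o).
Proof.
move=> a f h; rewrite /trace scaler_sumr -big_split /=; apply: eq_bigr => i _.
by rewrite add_lfunE scale_lfunE !ffunE.
Qed.

(** Commutators have trace 0. *)
Lemma trace_comp (f h : 'End(V)) : trace (f \o h)%VF = trace (h \o f)%VF.
Proof.
have mx (x y : 'End(V)) :
    trace (x \o y)%VF = \sum_i \sum_j y (e i) j * x (e j) i.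
  apply: eq_bigr => i _; rewrite comp_lfunE {1}(std_basis_sum (y (e i))).
  rewrite linear_sum sum_ffunE; apply: eq_bigr => j _.
  by rewrite linearZ ffunE.
rewrite !mx exchange_big /=; apply: eq_bigr => i _; apply: eq_bigr => j _.
by rewrite mulrC.
Qed.

Lemma ricci_linearl (R : 2.-tuple V -> 'End(V)) g w :
  wedge g R -> linear (fun v => ricci R v w : F^o).
Proof.
move=> wR a x y; rewrite /ricci /trace scaler_sumr -big_split /=.
apply: eq_bigr => i _.
by rewrite (wedge2_linearr _ wR) add_lfunE scale_lfunE !ffunE.
Qed.

Lemma ricci_linearr (R : 2.-tuple V -> 'End(V)) v :
  linear (fun w => ricci R v w : F^o).
Proof.
move=> a x y; rewrite /ricci /trace scaler_sumr -big_split /=.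
by apply: eq_bigr => i _; rewrite linearP !ffunE.
Qed.

Lemma ricci_std_basis (R1 R2 : 2.-tuple V -> 'End(V)) g :
    wedge g R1 -> wedge g R2 ->
    (forall i j, ricci R1 (e i) (e j) = ricci R2 (e i) (e j)) ->
  forall v w, ricci R1 v w = ricci R2 v w.
Proof.
move=> w1 w2 R12 v w; apply/eqP; rewrite -subr_eq0; apply/eqP.
pose D v w : F^o := ricci R1 v w - ricci R2 v w.
apply: (@linear_std_basis _ (D^~ w)) => [a x y|i].
  by rewrite /D (ricci_linearl _ w1) (ricci_linearl _ w2) scalerBr opprD addrACA.
apply: (@linear_std_basis _ (D (e i))) => [a x y|j]; last first.
  by rewrite /D R12 subrr.
by rewrite /D !ricci_linearr scalerBr opprD addrACA.
Qed.

Lemma sum3B (M : zmodType) (a b c a' b' c' : M) :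
  a + b + c = 0 -> a' + b' + c' = 0 -> a - a' + (b - b') + (c - c') = 0.
Proof.
move=> abc abc'; rewrite -[RHS](subrr (a + b + c)) {2}abc -abc' !opprD.
by rewrite [in RHS]addrACA [X in _ = X + _]addrACA.
Qed.

Lemma curvatureB (g : {vspace 'End(V)}) R1 R2 :
  curvature g R1 -> curvature g R2 -> curvature g (fun t => R1 t - R2 t).
Proof.
case=> [[lin1 alt1 in1] b1] [[lin2 alt2 in2] b2]; split=> [|u v w].
  split=> [v i a x y|v i j ij vij|v]; last by rewrite rpredB.
    by rewrite lin1 lin2 scalerBr opprD addrACA.
  by rewrite (alt1 v i j) // (alt2 v i j) // subrr.
by rewrite !(add_lfunE, opp_lfunE); apply: sum3B.
Qed.

Lemma ricci_flat_ricci_type (g : {vspace 'End(V)}) :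
    (forall R, curvature g R -> (forall v w, ricci R v w = 0) ->
      forall t, R t = 0) ->
  ricci_type g.
Proof.
move=> flat R1 R2 curv1 curv2 R12 t; apply/eqP; rewrite -subr_eq0; apply/eqP.
apply: (flat (fun t => R1 t - R2 t)); first exact: curvatureB.
move=> v w; have /eqP := R12 v w; rewrite -subr_eq0 => /eqP <-.
rewrite /ricci /trace -sumrB; apply: eq_bigr => i _.
by rewrite add_lfunE opp_lfunE !ffunE.
Qed.

End Basis.

(** * Exactness from the Ricci type and the second prolongation *)

Section Exactness.
Variables (F : fieldType) (I : finType).
Local Notation V := {ffun I -> F^o}.
Local Notation e := (std_basis F).
Variables (g : {vspace 'End(V)}) (br : graded g -> graded g -> graded g).
Hypotheses (lie : is_lie_bracket br) (gr : one_grading br).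
Hypothesis g_ricci : ricci_type g.
Hypothesis g_prol : second_prolongation_trivial g.
Hypothesis pairing_inj : forall p, (forall v, pairing br v p = 0) -> p = 0.

Definition coboundary m u v : 'End(V) :=
  pairing br u (dual_map m v) - pairing br v (dual_map m u).

Definition coboundary_form m (t : 2.-tuple V) : 'End(V) :=
  coboundary m (tnth t ord0) (tnth t ord_max).

Lemma coboundary_linearr m u : linear (coboundary m u).
Proof.
move=> a x y; rewrite /coboundary dual_map_linear (pairing_linearr lie).
by rewrite (pairing_linearl lie) scalerBr opprD addrACA.
Qed.

Lemma coboundary_anti m u v : coboundary m u v = - coboundary m v u.
Proof. by rewrite /coboundary opprB. Qed.

Lemma coboundary_curvature m : curvature g (coboundary_form m).
Proof.
split=> [|u v w].
  apply: (wedge2I (B := coboundary m)) => // [v a x y|u||u v].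
  - by rewrite !(coboundary_anti _ _ v) coboundary_linearr opprD scalerN.
  - exact: coboundary_linearr.
  - by move=> u; rewrite /coboundary subrr.
  by rewrite rpredB // pairing_in.
rewrite /coboundary_form /= !(tnth_nth 0) /= /coboundary !add_lfunE !opp_lfunE.
rewrite (pairing_sym lie gr v w) (pairing_sym lie gr w u).
by rewrite (pairing_sym lie gr u v) [X in X + _]addrC !subrKA subrr.
Qed.

(** A map with zero differential makes T(u, phi v) w symmetric in u, v, w. *)
Lemma coboundary_inj m : (forall u v, coboundary m u v = 0) -> m = 0.
Proof.
move=> m0; pose Q u v := pairing br u (dual_map m v).
have Q0 : forall u v, Q u v = 0.
  have Qsym u v : Q u v = Q v u by apply/eqP; rewrite -subr_eq0; apply/eqP/m0.
  apply: g_prol => //.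
  - by move=> u v; apply: pairing_in.
  - by move=> v; apply: pairing_linearl.
  - by move=> u a x y; rewrite /Q dual_map_linear (pairing_linearr lie).
  by move=> u v w; rewrite Qsym /Q (pairing_sym lie gr) -!/(Q _ _) Qsym.
apply/ffunP=> -[i j]; rewrite -dual_mapE ffunE.
by rewrite (pairing_inj (p := dual_map m (e i))) ?lfunE // => u; apply: Q0.
Qed.

Definition coboundary_ricci (m : {ffun I * I -> F^o}) : {ffun I * I -> F^o} :=
  [ffun ij => ricci (coboundary_form m) (e ij.1) (e ij.2)].

Lemma coboundary_ricci_linear : linear coboundary_ricci.
Proof.
move=> a m n; apply/ffunP=> -[i j]; rewrite !ffunE /ricci /trace.
rewrite scaler_sumr -big_split /=; apply: eq_bigr => k _.
rewrite /coboundary_form /coboundary !dual_map_linearl !(pairing_linearr lie).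
rewrite !(add_lfunE, opp_lfunE, scale_lfunE) !ffunE.
by rewrite scalerBr opprD addrACA.
Qed.

HB.instance Definition _ := GRing.isLinear.Build F {ffun I * I -> F^o}
  {ffun I * I -> F^o} *:%R coboundary_ricci coboundary_ricci_linear.

Lemma curvature0 : curvature g (fun=> 0).
Proof.
split=> [|u v w]; last by rewrite !lfunE !addr0.
by split=> [v i a x y|//|v]; rewrite ?scaler0 ?addr0 // mem0v.
Qed.

(** An injective endomorphism of a finite-dimensional space is onto. *)
Lemma coboundary_ricci_onto r : exists m, coboundary_ricci m = r.
Proof.
have ker0 : lker (linfun coboundary_ricci) == 0%VS.
  rewrite -subv0; apply/subvP=> m; rewrite memv_ker lfunE /= => /eqP m0.
  rewrite memv0; apply/eqP/coboundary_inj => u v.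
  have mw := (coboundary_curvature m).1.
  rewrite -[LHS]/(coboundary_form m [tuple u; v]).
  apply: (g_ricci (coboundary_curvature m) curvature0).
  apply: (ricci_std_basis mw curvature0.1) => i j.
  have /ffunP/(_ (i, j)) := m0; rewrite !ffunE /= => ->.
  by rewrite /ricci /trace big1 // => k _; rewrite lfunE ffunE.
exists ((linfun coboundary_ricci)^-1%VF r).
by rewrite -[LHS](lfunE coboundary_ricci) lker0_lfunVK.
Qed.

(** R agrees with the differential that has the same Ricci trace. *)
Lemma curvature_coboundary (R : 2.-tuple V -> 'End(V)) :
  curvature g R -> exists m, R =1 coboundary_form m.
Proof.
move=> Rcurv; have [m mE] :=
  coboundary_ricci_onto [ffun ij => ricci R (e ij.1) (e ij.2)].
exists m; apply: g_ricci => //; first exact: coboundary_curvature.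
apply: (ricci_std_basis Rcurv.1 (coboundary_curvature m).1) => i j.
by have /ffunP/(_ (i, j)) := mE; rewrite !ffunE.
Qed.

Local Notation m1 := (in_deg_m1 g).

Theorem cocycle_iff_coboundary (psi : 2.-tuple V -> graded g) :
  (wedge (deg0 g) psi /\ d_Lie br m1 psi =1 (fun=> 0)) <->
  (exists phi : 1.-tuple V -> graded g,
     wedge (deg1 g) phi /\ psi =1 d_Lie br m1 phi).
Proof.
split=> [[wpsi dpsi]|[phi [wphi psiE]]]; last first.
  exact: coboundary_cocycle wphi psiE.
have [m mE] := curvature_coboundary (cocycle_bianchi gr wpsi dpsi).
exists (fun t => in_deg1 g (dual_map m (tnth t ord0))); split.
  split=> [v i a x y|v i j|v];
    last by rewrite -[X in X \in _](lfunE (in_deg1 g)) memv_img ?memvf.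
    by rewrite !tnth_mktuple (ord1 i) eqxx dual_map_linear in_deg1_linear.
  by rewrite (ord1 i) (ord1 j).
move=> t; rewrite {2}[t]tuple2E d_Lie1 /=.
rewrite (deg0P (x := psi t)); last by case: wpsi.
rewrite (br_m1_d1 gr (tnth t ord0)) (br_m1_d1 gr (tnth t ord_max)) -linearB.
congr (in_deg0 _); apply: val_inj.
by rewrite /= -[LHS]/(deg0_part (psi t)) mE.
Qed.

End Exactness.

(** * The bracket of V with its dual *)

Section Perfect.
Variables (F : numFieldType) (I : finType).
Local Notation V := {ffun I -> F^o}.
Variables (g : {vspace 'End(V)}) (br : graded g -> graded g -> graded g).

(** The generators are combinations of brackets: h_i = [e_i, f_i],
2 e_i = [h_i, e_i] and -2 f_i = [h_i, f_i]. *)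
Lemma e6_perfect (L : vectType F) (b : L -> L -> L) (U : {vspace L}) :
  is_e6 b -> (forall x y, b x y \in U) -> U = fullv.
Proof.
case=> _ _ [e [f [h [_ ef he _ gen]]]] bU; apply: gen => // i.
have two : (2%:R : F) != 0 by rewrite pnatr_eq0.
have hU : h i \in U by have := bU (e i) (f i); rewrite ef eqxx.
have [] := he i i; rewrite /e6_cartan eqxx => he_i hf_i; split=> //.
  by have := bU (h i) (e i); rewrite he_i rpredZeq ?(negPf two).
have := bU (h i) (f i); rewrite hf_i rpredZeq oppr_eq0.
by rewrite (negPf two).
Qed.

Definition deg0_trace (x : graded g) : F^o := trace (deg0_part x).

Lemma deg0_trace_linear : linear deg0_trace.
Proof. by move=> a x y; rewrite /deg0_trace deg0_part_linear trace_linear. Qed.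

HB.instance Definition _ := GRing.isLinear.Build F (graded g) F^o *:%R
  deg0_trace deg0_trace_linear.

(** Otherwise the degree 0 part of every bracket is a commutator, of trace 0,
and so is that of every element of the perfect algebra e6, such as the identity
of V. *)
Lemma e6_pairing_neq0 :
    is_e6 br -> one_grading br -> \1%VF \in g -> (0 < #|I|)%N ->
  ~ (forall v p, pairing br v p = 0).
Proof.
move=> e6 gr id_g I_gt0 pair0; have lie : is_lie_bracket br by case: e6.
have full : lker (linfun deg0_trace) = fullv.
  apply: (e6_perfect e6) => x y; rewrite memv_ker lfunE /=.
  rewrite /deg0_trace (deg0_part_br lie gr) !pair0 addr0 subr0.
  by rewrite -scaleN1r addrC [X in X == _]trace_linear trace_comp scaleN1r addNr.
have : in_deg0 (Subvs id_g) \in lker (linfun deg0_trace) by rewrite full memvf.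
rewrite memv_ker lfunE /= /deg0_trace /deg0_part /= /trace.
rewrite (eq_bigr (fun=> 1)) => [|i _]; last by rewrite id_lfunE ffunE eqxx.
by rewrite sumr_const -[_ == _]/(#|I|%:R == 0) pnatr_eq0; case: #|I| I_gt0.
Qed.

End Perfect.

(** * The case of C + spin(10) *)

Section HalfSpin.
Variables (F : numFieldType) (b : bool).
Local Notation V := (half_spinor F b).
Local Notation e := (hdelta F b).
Local Notation g := (cspin10 F b).

Lemma linear_words (W : vectType F) (f : V -> W) :
  linear f -> {in words b, forall w, f (e w) = 0} -> forall v, f v = 0.
Proof.
move=> lin f0; apply: linear_std_basis => // u.
rewrite (std_basis_word F (w := wordof (val u))) ?wordofK // f0 //.
exact: half_indexP.
Qed.

Lemma cspin_ricci_type : ricci_type g.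
Proof.
apply: ricci_flat_ricci_type => R [wR bianchi] ric0 t.
rewrite (tuple2E t); move: (tnth t ord0) (tnth t ord_max) => u v.
have Re : {in words b &, forall x y, R [tuple e x; e y] = 0}.
  apply: (ricci_flat_zero (Y := fun x y => R [tuple e x; e y]))
    => [x y _ _|x y _ _|x y z _ _ _|y z _ _].
  - by case: wR.
  - exact: wedge2_anti wR.
  - exact: bianchi.
  rewrite -[RHS](ric0 (e y) (e z)) /ricci /trace; symmetry.
  apply: sum_half => w x wx.
  by rewrite (hcoordE _ wx) (std_basis_word F wx).
move: u; apply: (linear_words (wedge2_linearl v wR)) => x xb.
by move: v; apply: (linear_words (wedge2_linearr _ wR)) => y yb; apply: Re.
Qed.

Lemma cspin_second_prolongation : second_prolongation_trivial g.
Proof.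
move=> Q Qg linl linr Qsym Qprol u v.
move: u; apply: (linear_words (linl v)) => x xb.
move: v; apply: (linear_words (linr _)) => y yb.
by apply: (second_prolongation_zero (Y := fun x y => Q (e x) (e y))) xb yb => *.
Qed.

Section Bracket.
Variable br : graded g -> graded g -> graded g.
Hypotheses (e6 : is_e6 br) (gr : one_grading br).

(** The p with T(., p) = 0 form a proper submodule of the irreducible V^*. *)
Lemma cspin_pairing_inj p : (forall v, pairing br v p = 0) -> p = 0.
Proof.
have lie : is_lie_bracket br by case: e6.
move=> p0; apply/eqP.
apply: contra_notT (e6_pairing_neq0 e6 gr (id_in_cspin F b) _) => [pn0|].
  move=> v q; move: q v.
  apply: (dual_irreducible (N := fun p => forall v, pairing br v p = 0)) pn0 => //.
  - by move=> a q r q0 r0 v; rewrite (pairing_linearr lie) q0 r0 scaler0 addr0.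
  by move=> q A q0 gA; apply: (pairing_eq0_act lie gr gA q0).
have w0 : nth [::] (words b) 0 \in words b by rewrite mem_nth //; case: b.
have [u _] := half_indexE w0.
by apply/card_gt0P; exists u.
Qed.

End Bracket.
End HalfSpin.

Theorem theorem0p2 (R : realType) (b : bool)
    (br : graded (cspin10 R[i] b) -> graded (cspin10 R[i] b) ->
          graded (cspin10 R[i] b))
    (br_e6 : is_e6 br) (br_grading : one_grading br) :
  (forall psi : 2.-tuple (half_spinor R[i] b) -> graded (cspin10 R[i] b),
     (wedge (deg0 (cspin10 R[i] b)) psi /\
      d_Lie br (in_deg_m1 (cspin10 R[i] b)) psi =1 (fun=> 0))
     <->
     (exists phi : 1.-tuple (half_spinor R[i] b) -> graded (cspin10 R[i] b),
        wedge (deg1 (cspin10 R[i] b)) phi /\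
        psi =1 d_Lie br (in_deg_m1 (cspin10 R[i] b)) phi)) /\
  ricci_type (cspin10 R[i] b).
Proof.
have lie : is_lie_bracket br by case: br_e6.
split; last exact: cspin_ricci_type.
apply: (cocycle_iff_coboundary lie br_grading).
- exact: cspin_ricci_type.
- exact: cspin_second_prolongation.
exact: (cspin_pairing_inj br_e6 br_grading).
Qed.
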